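(* Let $R$ be a basic semiprimary ring with complete set $\{e_1,e_2,\ldots,e_n\}$ of primitive orthogonal idempotents of $R$, and let $\ell_1,\ell_2,\ldots,\ell_n$ be positive integers. If $R$ is quasi-hereditary, then so is the block extension $B(R;\ell_1,\ell_2,\ldots,\ell_n)$.
   Context: All rings are associative and unital; modules are right modules unless otherwise stated. $J(R)$ denotes the Jacobson radical of $R$. A ring $R$ is semiprimary if $J(R)$ is nilpotent and $R/J(R)$ is a semisimple (artinian) ring; semiprimary rings are semiperfect. A semiperfect ring $R$ with complete set $\{e_1,\ldots,e_n\}$ of primitive orthogonal idempotents (so $e_1+\cdots+e_n=1$) is basic if the modules $e_1R,\ldots,e_nR$ are pairwise non-isomorphic. A two-sided ideal $I$ of $R$ is an idempotent ideal if $I^2=I$. An idempotent ideal $H$ of $R$ is a heredity ideal if $H$ is a projective (right) $R$-module and $HJ(R)H=0$. A semiprimary ring $R$ is quasi-hereditary if it admits a heredity chain, i.e. a chain of two-sided ideals $R=H_0\supseteq H_1\supseteq\cdots\supseteq H_{m-1}\supseteq H_m=0$ such that $H_i/H_{i+1}$ is a heredity ideal of $R/H_{i+1}$ for each $0\le i\le m-1$. Block extension: let $R$ be a basic semiperfect ring with complete set $\{e_1,\ldots,e_n\}$ of primitive orthogonal idempotents and let $\ell_1,\ldots,\ell_n$ be positive integers. Put $R_{is}:=e_iRe_s$ and $R_i:=R_{ii}$ (a ring with identity $e_i$). For $1\le i,s\le n$ let $B(i,s)$ be the set of $\ell_i\times \ell_s$ matrices whose $(j,t)$-entry ($1\le j\le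 \ell_i$, $1\le t\le \ell_s$) ranges over $R_i$ if $i=s$ and $j\le t$; over $J(R_i)$ if $i=s$ and $j>t$; and over $R_{is}$ if $i\ne s$. The block extension $B(R;\ell_1,\ldots,\ell_n)$ is the ring of all block matrices $(b(i,s))_{1\le i,s\le n}$ with $b(i,s)\in B(i,s)$ (square matrices of size $\ell_1+\cdots+\ell_n$), with the usual matrix addition and multiplication. *)

(* Defs.v *)
Set Warnings "-notation-overridden,-ambiguous-paths".
Set Warnings "-redundant-canonical-projection,-projection-no-head-constant".
From HB Require Import structures.
From mathcomp Require Import all_boot all_order all_algebra.
From mathcomp Require Import boolp classical_sets.

Set Implicit Arguments.
Unset Strict Implicit.
Unset Printing Implicit Defensive.

Import GRing.Theory.

Local Open Scope classical_set_scope.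
Local Open Scope ring_scope.

(* Rings are [pzRingType]s, so that the zero ring (which occurs as the quotient
   R/H when H = R) is allowed.  A right R-module is an [lmodType] over the
   converse ring R^c. *)

Section Modules.
Context (S : pzRingType).

Definition projective_module (P : lmodType S) : Prop :=
  forall (M N : lmodType S) (g : {linear M -> N}) (f : {linear P -> N}),
    (forall y, exists x, g x = y) ->
    exists h : {linear P -> M}, forall p, g (h p) = f p.

Definition isomorphic_modules (M N : lmodType S) : Prop :=
  exists f : {linear M -> N}, bijective f.

End Modules.

(* Lets one write A x when A is a structure that coerces to set R. *)
Identity Coercion fun_of_set : set >-> Funclass.

Section Ideals.
Context (R : pzRingType).

Record right_ideal := RightIdeal {
  right_ideal_set :> set R;
  right_ideal0 : right_ideal_set 0;
  right_idealB : forall x y,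
    right_ideal_set x -> right_ideal_set y -> right_ideal_set (x - y);
  right_idealMr : forall x r, right_ideal_set x -> right_ideal_set (x * r)
}.

Record ideal := Ideal {
  ideal_right :> right_ideal;
  idealMl : forall r x, ideal_right x -> ideal_right (r * x)
}.

Lemma right_idealN (A : right_ideal) x : A x -> A (- x).
Proof. by move=> Ax; rewrite -sub0r; apply: right_idealB => //; apply: right_ideal0. Qed.

Lemma right_idealD (A : right_ideal) x y : A x -> A y -> A (x + y).
Proof.
by move=> Ax Ay; rewrite -[y]opprK; apply: right_idealB => //; apply: right_idealN.
Qed.

Lemma right_ideal_sum (A : right_ideal) (I : Type) (r : seq I) (P : pred I) F :
  (forall i, P i -> A (F i)) -> A (\sum_(i <- r | P i) F i).
Proof.
move=> AF; elim/big_ind: _ => //; first exact: right_ideal0.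
exact: right_idealD.
Qed.

Definition set_prod (A B : set R) : set R :=
  [set x | exists (k : nat) (a b : 'I_k -> R),
     [/\ forall i, A (a i), forall i, B (b i) & x = \sum_i a i * b i]].

Fixpoint set_pow (A : set R) (k : nat) : set R :=
  if k is k'.+1 then set_prod A (set_pow A k') else setT.

Definition nilpotent_set (A : set R) : Prop := exists k, set_pow A k = [set 0].

Definition principal_set (a : R) : set R := [set a * r | r in setT].

Lemma principal0 a : principal_set a 0.
Proof. by exists 0 => //; rewrite mulr0. Qed.

Lemma principalB a x y :
  principal_set a x -> principal_set a y -> principal_set a (x - y).
Proof. by move=> [r _ <-] [s _ <-]; exists (r - s) => //; rewrite mulrBr. Qed.

Lemma principalM a x r : principal_set a x -> principal_set a (x * r).
Proof. by move=> [s _ <-]; exists (s * r) => //; rewrite mulrA. Qed.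

Definition principal (a : R) : right_ideal :=
  RightIdeal (@principal0 a) (@principalB a) (@principalM a).

Definition maximal_right_ideal (M : right_ideal) : Prop :=
  (M : set R) <> setT /\
  forall K : right_ideal, M `<=` K -> (K : set R) = M \/ (K : set R) = setT.

Definition jacobson_set : set R :=
  [set x | forall M : right_ideal, maximal_right_ideal M -> M x].

Lemma jacobson0 : jacobson_set 0.
Proof. by move=> M _; apply: right_ideal0. Qed.

Lemma jacobsonB x y : jacobson_set x -> jacobson_set y -> jacobson_set (x - y).
Proof. by move=> Jx Jy M mM; apply: right_idealB; [apply: Jx|apply: Jy]. Qed.

Lemma jacobsonMr x r : jacobson_set x -> jacobson_set (x * r).
Proof. by move=> Jx M mM; apply/right_idealMr/Jx. Qed.

Section Add.
Context (M : right_ideal) (a : R).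
Let add_set : set R := [set x | exists m r, M m /\ x = m + a * r].
Fact right_ideal_add0 : add_set 0.
Proof. by exists 0, 0; split; [apply: right_ideal0|rewrite mulr0 addr0]. Qed.
Fact right_ideal_addB x y : add_set x -> add_set y -> add_set (x - y).
Proof.
move=> [m [r [Mm ->]]] [m' [r' [Mm' ->]]]; exists (m - m'), (r - r').
by split; [apply: right_idealB|rewrite mulrBr opprD addrACA].
Qed.
Fact right_ideal_addM x r : add_set x -> add_set (x * r).
Proof.
move=> [m [s [Mm ->]]]; exists (m * r), (s * r).
by split; [apply: right_idealMr|rewrite mulrDl mulrA].
Qed.
Definition right_ideal_add : right_ideal := RightIdeal right_ideal_add0 right_ideal_addB right_ideal_addM.
End Add.

Lemma maximal_right_idealP (M : right_ideal) a x : maximal_right_ideal M -> ~ M a ->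
  exists m r, M m /\ x = m + a * r.
Proof.
move=> [_ mM] nMa; have [||K] := mM (right_ideal_add M a).
- by move=> m Mm; exists m, 0; rewrite mulr0 addr0.
- move=> K; case: nMa; rewrite -K; exists 0, 1.
  by rewrite mulr1 add0r; split => //; apply: right_ideal0.
- suff: (right_ideal_add M a : set R) x by [].
  by rewrite K.
Qed.

Section Transporter.
Context (M : right_ideal) (a : R).
Let tr_set : set R := [set x | M (a * x)].
Fact transporter0 : tr_set 0. Proof. by rewrite /tr_set /= mulr0; apply: right_ideal0. Qed.
Fact transporterB x y : tr_set x -> tr_set y -> tr_set (x - y).
Proof. by rewrite /tr_set /= mulrBr; apply: right_idealB. Qed.
Fact transporterM x r : tr_set x -> tr_set (x * r).
Proof. by rewrite /tr_set /= mulrA; apply: right_idealMr. Qed.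
Definition transporter : right_ideal := RightIdeal transporter0 transporterB transporterM.
End Transporter.

Lemma maximal_transporter (M : right_ideal) a :
  maximal_right_ideal M -> ~ M a -> maximal_right_ideal (transporter M a).
Proof.
move=> mM nMa; split.
  move=> T; apply: nMa; suff: (transporter M a : set R) 1 by rewrite /= mulr1.
  by rewrite T.
move=> K sK; case: (pselect (exists2 z, K z & ~ M (a * z))) => [[z Kz nMz]|nK].
  right; apply/seteqP; split=> // w _.
  have [m [r [Mm eq]]] := maximal_right_idealP (a * w) mM nMz.
  rewrite -[w](subrK (z * r)); apply: right_idealD; last exact: right_idealMr.
  by apply: sK; rewrite /= mulrBr eq mulrA addrK.
left; apply/seteqP; split=> // z Kz /=.
by apply: contrapT => nMz; apply: nK; exists z.
Qed.

Lemma jacobsonMl r x : jacobson_set x -> jacobson_set (r * x).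
Proof.
move=> Jx M mM; case: (pselect (M r)) => [Mr|nMr]; first exact: right_idealMr.
exact: (Jx _ (maximal_transporter mM nMr)).
Qed.

Definition jacobson : ideal :=
  @Ideal (RightIdeal jacobson0 jacobsonB jacobsonMr) jacobsonMl.

(* The right regular module is semisimple: every submodule is a direct
   summand. *)
Definition semisimple_ring : Prop :=
  forall A : right_ideal, exists B : right_ideal,
    (A `&` B = [set 0]) /\
    (forall x, exists a b, [/\ A a, B b & x = a + b]).

End Ideals.


Section RightIdealModule.
Context (R : pzRingType) (A : right_ideal R).

(* (R^c)^o is R as a right module over itself, with r *: x = x * r. *)
Record right_ideal_module : Type := RightIdealModule {
  right_ideal_val : (R^c)^o;
  _ : right_ideal_val \in (A : set R)
}.

HB.instance Definition _ := [isSub for right_ideal_val].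
HB.instance Definition _ := [Choice of right_ideal_module by <:].

Fact right_ideal_submod_closed :
  submod_closed (fun x : (R^c)^o => x \in (A : set R)).
Proof.
split; first by apply/mem_set/right_ideal0.
move=> r x y; rewrite !inE => Ax Ay.
by apply: right_idealD => //; apply: right_idealMr.
Qed.

HB.instance Definition _ := GRing.SubChoice_isSubLmodule.Build R^c (R^c)^o
  (fun x => x \in (A : set R)) right_ideal_module right_ideal_submod_closed.

End RightIdealModule.

Section QuotientRing.
Context (R : pzRingType) (I : ideal R).

Definition ideal_mem : R -> bool := fun x => x \in (I : set R).

Fact ideal_mem_closed : zmod_closed ideal_mem.
Proof.
split; first by apply/mem_set/right_ideal0.
by move=> x y; rewrite -!topredE /= /ideal_mem !inE; apply: right_idealB.
Qed.

HB.instance Definition _ := GRing.isZmodClosed.Build R ideal_mem ideal_mem_closed.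

Definition ideal_pred : zmodClosed R := GRing.ZmodClosed.clone R ideal_mem _.
Definition quotient_ring : Type := Quotient.quot ideal_pred.

HB.instance Definition _ := GRing.Zmodule.on quotient_ring.

Definition to_quotient (x : R) : quotient_ring := \pi_(Quotient.quot ideal_pred)%qT x.

Fact to_quotientE x y : to_quotient x = to_quotient y <-> I (x - y).
Proof.
split=> [/eqP|Ixy]; last apply/eqP.
  by rewrite -Quotient.idealrBE /in_mem /= /ideal_mem inE.
by rewrite -Quotient.idealrBE /in_mem /= /ideal_mem inE.
Qed.

Definition quotient_repr (x : quotient_ring) : R :=
  repr (x : Quotient.quot ideal_pred).

Fact quotient_reprK x : to_quotient (quotient_repr x) = x.
Proof. exact: reprK. Qed.

Fact to_quotient_surj x : exists y, to_quotient y = x.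
Proof. by exists (quotient_repr x); apply: quotient_reprK. Qed.

Fact to_quotient_is_zmod_morphism : zmod_morphism to_quotient.
Proof. by move=> x y; rewrite /to_quotient piE. Qed.

Definition quotient_one : quotient_ring := to_quotient 1.
Definition quotient_mul (x y : quotient_ring) : quotient_ring :=
  to_quotient (quotient_repr x * quotient_repr y).

Fact to_quotient_mul x y :
  to_quotient (x * y) = quotient_mul (to_quotient x) (to_quotient y).
Proof.
apply/to_quotientE; set x' := quotient_repr _; set y' := quotient_repr _.
have Ix : I (x - x') by apply/to_quotientE; rewrite quotient_reprK.
have Iy : I (y - y') by apply/to_quotientE; rewrite quotient_reprK.
rewrite -[x * y](subrK (x' * y)) -addrA -mulrBl -mulrBr.
by apply: right_idealD; [apply: right_idealMr|apply: idealMl].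
Qed.

Fact quotient_mulA : associative quotient_mul.
Proof.
move=> x y z; case: (to_quotient_surj x) (to_quotient_surj y) (to_quotient_surj z).
by move=> {}x <- [{}y <-] [{}z <-]; rewrite -!to_quotient_mul mulrA.
Qed.

Fact quotient_mul1 : left_id quotient_one quotient_mul.
Proof.
by move=> x; case: (to_quotient_surj x) => {}x <-; rewrite -to_quotient_mul mul1r.
Qed.

Fact quotient_mulr1 : right_id quotient_one quotient_mul.
Proof.
by move=> x; case: (to_quotient_surj x) => {}x <-; rewrite -to_quotient_mul mulr1.
Qed.

Fact to_quotientD x y : to_quotient (x + y) = to_quotient x + to_quotient y.
Proof. by rewrite /to_quotient piE. Qed.

Fact quotient_mulDl : left_distributive quotient_mul +%R.
Proof.
move=> x y z; case: (to_quotient_surj x) (to_quotient_surj y) (to_quotient_surj z).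
move=> {}x <- [{}y <-] [{}z <-].
by rewrite -to_quotientD -!to_quotient_mul mulrDl to_quotientD.
Qed.

Fact quotient_mulDr : right_distributive quotient_mul +%R.
Proof.
move=> x y z; case: (to_quotient_surj x) (to_quotient_surj y) (to_quotient_surj z).
move=> {}x <- [{}y <-] [{}z <-].
by rewrite -to_quotientD -!to_quotient_mul mulrDr to_quotientD.
Qed.

HB.instance Definition _ := GRing.Zmodule_isPzRing.Build quotient_ring
  quotient_mulA quotient_mul1 quotient_mulr1 quotient_mulDl quotient_mulDr.

Fact to_quotient_is_monoid_morphism : monoid_morphism to_quotient.
Proof. by split=> // x y; rewrite to_quotient_mul. Qed.

HB.instance Definition _ := GRing.isZmodMorphism.Build R quotient_ring to_quotient
  to_quotient_is_zmod_morphism.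
HB.instance Definition _ := GRing.isMonoidMorphism.Build R quotient_ring to_quotient
  to_quotient_is_monoid_morphism.

Section QuotientIdeal.
Context (K : ideal R).

Definition quotient_set : set quotient_ring := [set to_quotient x | x in (K : set R)].

Fact quotient_set0 : quotient_set 0.
Proof. by exists 0; [apply: right_ideal0|rewrite rmorph0]. Qed.

Fact quotient_setB x y : quotient_set x -> quotient_set y -> quotient_set (x - y).
Proof.
move=> [a Ka <-] [b Kb <-]; exists (a - b); last by rewrite rmorphB.
exact: right_idealB.
Qed.

Fact quotient_setMr x r : quotient_set x -> quotient_set (x * r).
Proof.
move=> [a Ka <-]; case: (to_quotient_surj r) => s <-.
by exists (a * s); [apply: right_idealMr|rewrite rmorphM].
Qed.

Fact quotient_setMl r x : quotient_set x -> quotient_set (r * x).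
Proof.
move=> [a Ka <-]; case: (to_quotient_surj r) => s <-.
by exists (s * a); [apply: idealMl|rewrite rmorphM].
Qed.

(* The ideal (K + I)/I of R/I, that is K/I when I is contained in K. *)
Definition quotient_ideal : ideal quotient_ring :=
  @Ideal _ (RightIdeal quotient_set0 quotient_setB quotient_setMr) quotient_setMl.

End QuotientIdeal.
End QuotientRing.

Definition semiprimary (R : pzRingType) : Prop :=
  nilpotent_set (jacobson R) /\ semisimple_ring (quotient_ring (jacobson R)).

Definition heredity_ideal (R : pzRingType) (H : ideal R) : Prop :=
  [/\ set_prod H H = H,
      projective_module (right_ideal_module H) &
      set_prod (set_prod H (jacobson R)) H = [set 0]].

Definition heredity_chain (R : pzRingType) (m : nat) (H : nat -> ideal R) : Prop :=
  [/\ (H 0%N : set R) = setT, (H m : set R) = [set 0] &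
      forall i, (i < m)%N ->
        H i.+1 `<=` H i /\ heredity_ideal (quotient_ideal (H i.+1) (H i))].

Definition quasi_hereditary (R : pzRingType) : Prop :=
  semiprimary R /\ exists (m : nat) (H : nat -> ideal R), heredity_chain m H.

Record idempotent_elt (R : pzRingType) := IdempotentElt {
  idempotent_val :> R;
  idempotentP : idempotent_val * idempotent_val = idempotent_val
}.

Section Idempotents.
Context (R : pzRingType).

Definition primitive_idempotent (e : idempotent_elt R) : Prop :=
  (e : R) <> 0 /\
  forall f g : idempotent_elt R,
    (f : R) * (g : R) = 0 -> (g : R) * (f : R) = 0 -> (e : R) = (f : R) + (g : R) ->
    (f : R) = 0 \/ (g : R) = 0.

Definition complete_primitive_orthogonal n (e : 'I_n -> idempotent_elt R) : Prop :=
  [/\ forall i, primitive_idempotent (e i),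
      forall i s, i != s -> (e i : R) * (e s : R) = 0 &
      \sum_i (e i : R) = 1].

Definition basic_idempotents n (e : 'I_n -> idempotent_elt R) : Prop :=
  forall i s, i != s ->
    ~ isomorphic_modules (right_ideal_module (principal (e i : R)))
                         (right_ideal_module (principal (e s : R))).

Definition peirce (e f : idempotent_elt R) : set R :=
  [set (e : R) * r * (f : R) | r in [set: R]].

Lemma peirceE e f x : peirce e f x <-> (e : R) * x * (f : R) = x.
Proof.
split=> [[r _ <-]|<-]; last by exists x.
by rewrite !mulrA idempotentP -!mulrA idempotentP.
Qed.

Lemma peirce_l e f x : peirce e f x -> (e : R) * x = x.
Proof. by move=> [r _ <-]; rewrite !mulrA idempotentP. Qed.

Lemma peirce_r e f x : peirce e f x -> x * (f : R) = x.
Proof. by move=> [r _ <-]; rewrite -!mulrA idempotentP. Qed.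

Lemma peirce0 e f : peirce e f 0.
Proof. by apply/peirceE; rewrite mulr0 mul0r. Qed.

Lemma peirceB e f x y : peirce e f x -> peirce e f y -> peirce e f (x - y).
Proof.
by move=> /peirceE ex /peirceE ey; apply/peirceE; rewrite mulrBr mulrBl ex ey.
Qed.

Lemma peirceM e f g x y : peirce e f x -> peirce f g y -> peirce e g (x * y).
Proof.
move=> ex ey; apply/peirceE.
by rewrite mulrA (peirce_l ex) -mulrA (peirce_r ey).
Qed.

Lemma peirce_id e : peirce e e (e : R).
Proof. by apply/peirceE; rewrite !idempotentP. Qed.

End Idempotents.

Section Corner.
Context (R : pzRingType) (e : idempotent_elt R).

(* The ring e R e, with identity e. *)
Record corner : Type := Corner {
  corner_val : R;
  _ : corner_val \in peirce e e
}.

HB.instance Definition _ := [isSub for corner_val].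
HB.instance Definition _ := [Choice of corner by <:].

Fact corner_zmod_closed : zmod_closed (fun x => x \in peirce e e).
Proof.
split; first by apply/mem_set/peirce0.
by move=> x y; rewrite -!topredE /= !inE; apply: peirceB.
Qed.

HB.instance Definition _ :=
  GRing.SubChoice_isSubZmodule.Build R (fun x => x \in peirce e e) corner
    corner_zmod_closed.

Lemma cornerP (x : corner) : peirce e e (corner_val x).
Proof. by case: x => x /= /set_mem. Qed.

Lemma corner_inj : injective corner_val.
Proof. exact: val_inj. Qed.

Definition to_corner x (Px : peirce e e x) : corner := Corner (mem_set Px).
Definition corner_one : corner := to_corner (peirce_id e).
Definition corner_mul (x y : corner) : corner :=
  to_corner (peirceM (cornerP x) (cornerP y)).

Fact corner_valB x y : corner_val (x - y) = corner_val x - corner_val y.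
Proof. exact: (raddfB (val : corner -> R)). Qed.
Fact corner_valD x y : corner_val (x + y) = corner_val x + corner_val y.
Proof. exact: (raddfD (val : corner -> R)). Qed.
Fact corner_val0 : corner_val 0 = 0.
Proof. exact: (raddf0 (val : corner -> R)). Qed.

Fact corner_mulA : associative corner_mul.
Proof. by move=> x y z; apply: corner_inj; rewrite /= mulrA. Qed.
Fact corner_mul1 : left_id corner_one corner_mul.
Proof. by move=> x; apply: corner_inj; rewrite /= (peirce_l (cornerP x)). Qed.
Fact corner_mulr1 : right_id corner_one corner_mul.
Proof. by move=> x; apply: corner_inj; rewrite /= (peirce_r (cornerP x)). Qed.
Fact corner_mulDl : left_distributive corner_mul +%R.
Proof.
move=> x y z; apply: corner_inj.
by rewrite corner_valD -[LHS]/(corner_val (x + y) * corner_val z) corner_valD mulrDl.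
Qed.
Fact corner_mulDr : right_distributive corner_mul +%R.
Proof.
move=> x y z; apply: corner_inj.
by rewrite corner_valD -[LHS]/(corner_val x * corner_val (y + z)) corner_valD mulrDr.
Qed.

HB.instance Definition _ := GRing.Zmodule_isPzRing.Build corner
  corner_mulA corner_mul1 corner_mulr1 corner_mulDl corner_mulDr.

Fact corner_valM (x y : corner) : corner_val (x * y) = corner_val x * corner_val y.
Proof. by []. Qed.
Fact corner_val1 : corner_val 1 = (e : R).
Proof. by []. Qed.

Definition corner_jacobson : set R :=
  [set corner_val x | x in (jacobson corner : set corner)].

End Corner.

Section Local.
Context (R : pzRingType) (e : idempotent_elt R).
Hypotheses (spR : semiprimary R) (prim_e : primitive_idempotent e).
Implicit Types x y u v : corner e.

Let J := jacobson R.

Lemma corner_regular x : exists y, J (corner_val (x - x * y * x)).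
Proof.
case: spR => _ ssR; set q := to_quotient J; set x' := q (corner_val x).
have [B [AB /(_ 1) [a [b [[r _ <-] Bb eq1]]]]] := ssR (principal x').
case: (to_quotient_surj r) => s ds.
have Ps : peirce e e ((e : R) * s * (e : R)) by exists s.
exists (to_corner Ps).
have eqx : corner_val (x - x * to_corner Ps * x) =
    corner_val x - corner_val x * s * corner_val x.
  rewrite corner_valB !corner_valM /= !mulrA (peirce_r (cornerP x)).
  by rewrite -!mulrA (peirce_l (cornerP x)).
rewrite eqx.
have eqb : b * x' = x' - x' * r * x'.
  by rewrite -{2}[x']mul1r eq1 mulrDl addrAC subrr add0r.
have eqq : q (corner_val x - corner_val x * s * corner_val x) = x' - x' * r * x'.
  by rewrite /x' -ds /q rmorphB !rmorphM.
suff: (principal x' `&` B) (b * x').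
  rewrite AB eqb -eqq => eq0; rewrite -[corner_val x - _]subr0.
  by apply/to_quotientE; rewrite -/q eq0 /q rmorph0.
split; last exact: right_idealMr.
by exists (1 - r * x') => //; rewrite mulrBr mulr1 mulrA -eqb.
Qed.

Lemma corner_nilp x : J (corner_val x) -> exists N, x ^+ N = 0.
Proof.
case: spR => -[N nilJ] _ Jx; exists N.
suff: [set (0 : R)] (corner_val (x ^+ N)).
  by move=> /= x0; apply: corner_inj; rewrite x0 corner_val0.
rewrite -nilJ; elim: N {nilJ} => [//|N IH].
exists 1%N, (fun=> corner_val x), (fun=> corner_val (x ^+ N)).
by split=> //; rewrite big_ord1 exprS.
Qed.

Lemma nilp_inv1B x N : x ^+ N = 0 -> exists y, (1 - x) * y = 1.
Proof.
move=> xN0; exists (\sum_(i < N) x ^+ i).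
by have := subrX1 x N; rewrite xN0 sub0r -[x - 1]opprB mulNr => /oppr_inj.
Qed.

Lemma corner_local x : (exists y, x * y = 1) \/ (exists y, (1 - x) * y = 1).
Proof.
have [y Jy] := corner_regular x.
pose u := x * y; pose v := 1 - u.
have cuv : GRing.comm u v by rewrite /GRing.comm mulrBr mulrBl mulr1 mul1r.
have uDv : u + v = 1 by rewrite addrC subrK.
have [N uvN] : exists N, (u * v) ^+ N = 0.
  apply: corner_nilp; have -> : u * v = (x - x * y * x) * y.
    by rewrite /v mulrBr mulr1 mulrBl /u !mulrA.
  by rewrite corner_valM; apply: (jacobsonMr (corner_val y) Jy).
have uv0 a b : (N <= a)%N -> (N <= b)%N -> u ^+ a * v ^+ b = 0.
  move=> Na Nb; rewrite -(subnK Na) -(subnKC Nb) !exprD -mulrA (mulrA (u ^+ N)).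
  by rewrite -exprMn_comm // uvN mul0r mulr0.
pose T (i : 'I_(N + N).+1) := u ^+ (N + N - i) * v ^+ i *+ 'C(N + N, i).
pose g := \sum_(i : 'I_(N + N).+1 | (i <= N)%N) T i; pose h := \sum_(i : 'I_(N + N).+1 | ~~ (i <= N)%N) T i.
have gDh : g + h = 1.
  by rewrite -(expr1n _ (N + N)) -uDv exprDn_comm // (bigID (fun i : 'I_(N + N).+1 => (i <= N)%N)).
have cvu a b : v ^+ a * u ^+ b = u ^+ b * v ^+ a.
  by apply/commrX/commr_sym/commrX.
have T2 (i j : 'I_(N + N).+1) :
    (i <= N)%N -> ~~ (j <= N)%N -> T i * T j = 0 /\ T j * T i = 0.
  rewrite -ltnNge => iN /ltnW Nj; rewrite /T !mulrnAl !mulrnAr.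
  have Ni : (N <= N + N - i)%N by rewrite -{1}(addnK N N) leq_sub2l.
  have E k l : u ^+ (N + N - k) * v ^+ k * (u ^+ (N + N - l) * v ^+ l) =
      u ^+ (N + N - k + (N + N - l)) * v ^+ (k + l).
    by rewrite -mulrA [v ^+ k * _]mulrA cvu -mulrA -exprD mulrA -exprD.
  split; rewrite E uv0 ?mul0rn //.
  - exact: leq_trans Ni (leq_addr _ _).
  - exact: leq_trans Nj (leq_addl _ _).
  - exact: leq_trans Ni (leq_addl _ _).
  - exact: leq_trans Nj (leq_addr _ _).
have gh0 : g * h = 0.
  by rewrite mulr_suml big1// => i iN; rewrite mulr_sumr big1// => j jN; case: (T2 i j).
have hg0 : h * g = 0.
  by rewrite mulr_suml big1// => j jN; rewrite mulr_sumr big1// => i iN; case: (T2 i j).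
have gg : g * g = g by rewrite -{3}[g]mulr1 -gDh mulrDr gh0 addr0.
have hh : h * h = h by rewrite -{3}[h]mulr1 -gDh mulrDr hg0 add0r.
pose g' := @IdempotentElt R (corner_val g) (f_equal (@corner_val _ _) gg).
pose h' := @IdempotentElt R (corner_val h) (f_equal (@corner_val _ _) hh).
have [] : (g' : R) = 0 \/ (h' : R) = 0.
- case: prim_e => _; apply; rewrite /= -?corner_valM ?gh0 ?hg0 ?corner_val0 //.
  by rewrite -corner_valD gDh.
- move=> g0; right.
  have {}g0 : g = 0 by apply: corner_inj; rewrite corner_val0.
  have uN : u ^+ N = 0.
    rewrite -[LHS]mulr1 -gDh g0 add0r mulr_sumr big1// => j; rewrite -ltnNge => Nj.
    by rewrite mulrnAr mulrA -exprD uv0 ?mul0rn ?leq_addr // ltnW.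
  have Jk k : J (corner_val (x - u ^+ k * x)).
    elim: k => [|k IH].
      by rewrite expr0 mul1r subrr corner_val0; apply: right_ideal0.
    have -> : x - u ^+ k.+1 * x = (x - u * x) + u * (x - u ^+ k * x).
      by rewrite mulrBr addrA subrK mulrA -exprS.
    rewrite corner_valD; apply: right_idealD; first exact: Jy.
    by rewrite corner_valM; apply: idealMl.
  have := Jk N; rewrite uN mul0r subr0 => /corner_nilp[M xM].
  exact: nilp_inv1B xM.
- move=> h0; left.
  have {}h0 : h = 0 by apply: corner_inj; rewrite corner_val0.
  have vN : v ^+ N = 0.
    rewrite -[LHS]mulr1 -gDh h0 addr0 mulr_sumr big1// => j jN.
    rewrite mulrnAr mulrA cvu -mulrA -exprD uv0 ?mul0rn ?leq_addr //.
    by rewrite -{1}(addnK N N) leq_sub2l.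
  have [z uz] := nilp_inv1B vN; exists (y * z).
  by rewrite mulrA -[LHS]/(u * z) -[RHS]uz /v opprB [1 + _]addrC subrK.
Qed.

End Local.

Section OffDiagonal.
Context (R : pzRingType) (e f : idempotent_elt R).
Hypotheses (spR : semiprimary R).
Hypotheses (prim_e : primitive_idempotent e) (prim_f : primitive_idempotent f).

Section Isomorphism.
Context (a c : R) (fce : peirce f e c) (eaf : peirce e f a).
Hypotheses (ac : a * c = (e : R)) (ca : c * a = (f : R)).

Let M := right_ideal_module (principal (e : R)).
Let N := right_ideal_module (principal (f : R)).

Fact iso_fun_subproof (x : M) :
  c * (right_ideal_val x : R) \in (principal (f : R) : set R).
Proof.
case: x => x /= _; apply/mem_set; exists (c * x) => //.
by rewrite mulrA (peirce_l fce).
Qed.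
Fact iso_inv_subproof (x : N) :
  a * (right_ideal_val x : R) \in (principal (e : R) : set R).
Proof.
case: x => x /= _; apply/mem_set; exists (a * x) => //.
by rewrite mulrA (peirce_l eaf).
Qed.
Definition iso_fun (x : M) : N := RightIdealModule (iso_fun_subproof x).
Definition iso_inv (x : N) : M := RightIdealModule (iso_inv_subproof x).

Fact iso_fun_is_linear : linear iso_fun.
Proof.
move=> r x y; apply: val_inj.
rewrite [RHS](linearP (val : N -> (R^c)^o)).
rewrite -[LHS]/(c * (val (r *: x + y) : R)) (linearP (val : M -> (R^c)^o)).
by rewrite [LHS](mulrDr c); congr (_ + _); apply: (mulrA c).
Qed.

HB.instance Definition _ := GRing.isLinear.Build R^c M N *:%R iso_fun iso_fun_is_linear.

Fact iso_funP : isomorphic_modules M N.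
Proof.
exists iso_fun; exists iso_inv => -[x Px]; apply: val_inj => /=.
  by rewrite mulrA ac; move: Px => /set_mem[y _ <-]; rewrite mulrA idempotentP.
by rewrite mulrA ca; move: Px => /set_mem[y _ <-]; rewrite mulrA idempotentP.
Qed.

End Isomorphism.

Lemma off_diagonal a b :
  ~ isomorphic_modules (right_ideal_module (principal (e : R)))
                       (right_ideal_module (principal (f : R))) ->
  peirce e f a -> peirce f e b -> corner_jacobson e (a * b).
Proof.
move=> niso ea fb; pose z := to_corner (peirceM ea fb).
exists z => // M mM; apply: contrapT => nMz.
have [m [r [Mm eq1]]] := maximal_right_idealP 1 mM nMz.
case: (corner_local spR prim_e m) => [[y my]|[y zry]].
  case: mM => + _; apply; apply/seteqP; split => // w _.
  by rewrite -[w]mul1r -my -mulrA; apply: right_idealMr.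
have {}zry : z * r * y = 1 by rewrite -zry eq1 [m + _]addrC addrK.
pose c := b * corner_val (r * y).
have fc : peirce f e c by apply: peirceM fb (cornerP _).
have ac : a * c = (e : R) by rewrite -[RHS]/(corner_val 1) -zry -mulrA /c mulrA.
have ff : c * a * (c * a) = c * a by rewrite -mulrA (mulrA a) ac (peirce_l ea).
have fcaf : peirce f f (c * a) by apply: peirceM fc ea.
have fl := peirce_l fcaf; have fr := peirce_r fcaf.
have gg : ((f : R) - c * a) * ((f : R) - c * a) = (f : R) - c * a.
  by rewrite mulrBr !mulrBl idempotentP ff fl fr subrr subr0.
have [] : c * a = 0 \/ (f : R) - c * a = 0.
- case: prim_f => _ /(_ (IdempotentElt ff) (IdempotentElt gg)) /=; apply.
  + by rewrite mulrBr fr ff subrr.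
  + by rewrite mulrBl fl ff subrr.
  + by rewrite addrC subrK.
- move=> ca0; case: prim_e => + _; apply.
  by rewrite -idempotentP -ac -mulrA (mulrA c) ca0 mul0r mulr0.
- move/eqP; rewrite subr_eq0 => /eqP fE; apply: niso.
  exact: (iso_funP fc ea ac (esym fE)).
Qed.

End OffDiagonal.

Section BlockExtension.
Context (R : pzRingType) (n : nat) (e : 'I_n -> idempotent_elt R).
Context (l : 'I_n -> nat).

Definition block_entry (i s : 'I_n) (j t : nat) : set R :=
  if i == s then
    if (j <= t)%N then peirce (e i) (e i) else corner_jacobson (e i)
  else peirce (e i) (e s).

Definition block_set : set 'M[R]_(\sum_(i < n) l i) :=
  [set A | forall (i s : 'I_n) (j : 'I_(l i)) (t : 'I_(l s)),
             block_entry i s j t (submxblock A i s j t)].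

Lemma corner_jacobson_peirce (f : idempotent_elt R) x :
  corner_jacobson f x -> peirce f f x.
Proof. by move=> [y _ <-]; apply: cornerP. Qed.

Lemma block_entry_peirce i s j t x : block_entry i s j t x -> peirce (e i) (e s) x.
Proof.
rewrite /block_entry; case: eqP => [<-|//]; case: ifP => // _.
exact: corner_jacobson_peirce.
Qed.

Lemma block_entry0 i s j t : block_entry i s j t 0.
Proof.
rewrite /block_entry; case: ifP => _; last exact: peirce0.
case: ifP => _; first exact: peirce0.
by exists 0; [apply: right_ideal0|rewrite corner_val0].
Qed.

Lemma block_entryB i s j t x y :
  block_entry i s j t x -> block_entry i s j t y -> block_entry i s j t (x - y).
Proof.
rewrite /block_entry; case: ifP => _; last exact: peirceB.
case: ifP => _; first exact: peirceB.
move=> [a Ja <-] [b Jb <-]; exists (a - b); last by rewrite corner_valB.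
exact: right_idealB.
Qed.

Lemma block_entry_sum i s j t (I : Type) (r : seq I) (P : pred I) (F : I -> R) :
  (forall k, P k -> block_entry i s j t (F k)) ->
  block_entry i s j t (\sum_(k <- r | P k) F k).
Proof.
move=> PF; elim/big_ind: _ => //; first exact: block_entry0.
move=> x y Bx By; rewrite -[y]opprK; apply: block_entryB => //.
by rewrite -sub0r; apply: block_entryB => //; apply: block_entry0.
Qed.

Hypothesis spR : semiprimary R.
Hypothesis comp_e : complete_primitive_orthogonal e.
Hypothesis basic_e : basic_idempotents e.

Lemma block_entryM i k s j q t x y :
  block_entry i k j q x -> block_entry k s q t y -> block_entry i s j t (x * y).
Proof.
move=> Bx By; have Px := block_entry_peirce Bx; have Py := block_entry_peirce By.
rewrite /block_entry; case: eqP => [eis|_]; last exact: peirceM Px Py.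
subst s; case: ifP => [_|jt]; first exact: peirceM Px Py.
have [ik|neik] := eqVneq i k; last first.
  have [prim_e _ _] := comp_e.
  exact: (off_diagonal spR (prim_e i) (prim_e k) (basic_e neik)).
subst k; move: Bx By; rewrite /block_entry eqxx.
case: ifP => [jq _|_ [a Ja <-] _].
  rewrite ifF; last by apply: contraFF jt; apply: leq_trans.
  move=> [b Jb <-]; exists (to_corner Px * b) => //; exact: idealMl.
exists (a * to_corner Py) => //; exact: right_idealMr.
Qed.

Lemma block_setB A B : block_set A -> block_set B -> block_set (A - B).
Proof.
move=> hA hB i s j t; rewrite submxblockB !mxE.
by apply: block_entryB; [have := hA i s j t|have := hB i s j t]; rewrite !mxE.
Qed.

Lemma submxblockM (A B : 'M[R]_(\sum_(i < n) l i)) i s :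
  submxblock (A *m B) i s = \sum_k submxblock A i k *m submxblock B k s.
Proof. by rewrite -{1}[A]submxblockK -{1}[B]submxblockK mul_mxblock mxblockK. Qed.

Lemma block_setM A B : block_set A -> block_set B -> block_set (A *m B).
Proof.
move=> hA hB i s j t; rewrite submxblockM summxE.
apply: block_entry_sum => k _; rewrite mxE.
by apply: block_entry_sum => q _; apply: block_entryM (hA i k j q) (hB k s q t).
Qed.

(* The identity of the block extension is not the identity matrix 1%:M. *)
Definition block_one : 'M[R]_(\sum_(i < n) l i) :=
  \mxdiag_(i < n) ((e i : R)%:M : 'M[R]_(l i)).

Lemma block_set1 : block_set block_one.
Proof.
move=> i s j t; rewrite /block_one mxblockK.
case: (eqVneq i s) => [eis|_]; last by rewrite mxE; apply: block_entry0.
subst s; rewrite conform_mx_id mxE.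
case: eqP => [->|_]; last by rewrite mulr0n; apply: block_entry0.
by rewrite mulr1n /block_entry eqxx leqnn; apply: peirce_id.
Qed.

Lemma block_mul1 A : block_set A -> block_one *m A = A.
Proof.
move=> hA; rewrite -{1}[A]submxblockK mul_mxdiag_mxblock -[RHS]submxblockK.
apply/eq_mxblockP => i s; apply/matrixP => j t; rewrite mul_scalar_mx mxE.
exact: peirce_l (block_entry_peirce (hA i s j t)).
Qed.

Lemma block_mulr1 A : block_set A -> A *m block_one = A.
Proof.
move=> hA; rewrite -{1}[A]submxblockK mul_mxblock_mxdiag -[RHS]submxblockK.
apply/eq_mxblockP => i s; apply/matrixP => j t; rewrite mxE (bigD1 t) //=.
rewrite big1 => [|q qt]; first rewrite addr0 [_%:M _ _]mxE eqxx mulr1n.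
  exact: peirce_r (block_entry_peirce (hA i s j t)).
by rewrite [_%:M _ _]mxE (negPf qt) mulr0n mulr0.
Qed.

End BlockExtension.

Arguments block_set {R n} e l.

(* The hypotheses on R and e are arguments of the type because closure under
   multiplication depends on them: e_i R e_s R e_i must lie in J(e_i R e_i) for
   i <> s. *)
Record block_extension (R : pzRingType) (n : nat) (e : 'I_n -> idempotent_elt R)
    (spR : semiprimary R) (comp_e : complete_primitive_orthogonal e)
    (basic_e : basic_idempotents e) (l : 'I_n -> nat) : Type := BlockExtension {
  block_val : 'M[R]_(\sum_(i < n) l i);
  _ : block_val \in block_set e l
}.

Section BlockExtensionRing.
Context (R : pzRingType) (n : nat) (e : 'I_n -> idempotent_elt R).
Context (spR : semiprimary R) (comp_e : complete_primitive_orthogonal e).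
Context (basic_e : basic_idempotents e) (l : 'I_n -> nat).

Local Notation B := (block_extension spR comp_e basic_e l).

HB.instance Definition _ := [isSub of B for @block_val R n e spR comp_e basic_e l].
HB.instance Definition _ := [Choice of B by <:].

Fact block_zmod_closed : zmod_closed (fun A => A \in block_set e l).
Proof.
split; first by apply/mem_set => i s j t; rewrite submxblock0 mxE; apply: block_entry0.
by move=> X Y; rewrite -!topredE /= !inE; apply: block_setB.
Qed.

HB.instance Definition _ :=
  GRing.SubChoice_isSubZmodule.Build _ (fun A => A \in block_set e l) B
    block_zmod_closed.

Lemma blockP (X : B) : block_set e l (block_val X).
Proof. by case: X => X /= /set_mem. Qed.

Definition block_ext_one : B :=
  BlockExtension spR comp_e basic_e (mem_set (@block_set1 R n e l)).
Definition block_ext_mul (X Y : B) : B :=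
  BlockExtension spR comp_e basic_e
    (mem_set (block_setM spR comp_e basic_e (blockP X) (blockP Y))).

Fact block_ext_valD (X Y : B) : block_val (X + Y) = block_val X + block_val Y.
Proof. exact: (raddfD (val : B -> _)). Qed.

Fact block_ext_mulA : associative block_ext_mul.
Proof. by move=> X Y Z; apply: val_inj; rewrite /= mulmxA. Qed.
Fact block_ext_mul1 : left_id block_ext_one block_ext_mul.
Proof. by move=> X; apply: val_inj; apply: block_mul1 (blockP X). Qed.
Fact block_ext_mulr1 : right_id block_ext_one block_ext_mul.
Proof. by move=> X; apply: val_inj; apply: block_mulr1 (blockP X). Qed.
Fact block_ext_mulDl : left_distributive block_ext_mul +%R.
Proof.
move=> X Y Z; apply: val_inj.
by rewrite [RHS]block_ext_valD -[LHS]/(block_val (X + Y) *m block_val Z)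
  block_ext_valD mulmxDl.
Qed.
Fact block_ext_mulDr : right_distributive block_ext_mul +%R.
Proof.
move=> X Y Z; apply: val_inj.
by rewrite [RHS]block_ext_valD -[LHS]/(block_val X *m block_val (Y + Z))
  block_ext_valD mulmxDr.
Qed.

HB.instance Definition _ := GRing.Zmodule_isPzRing.Build B
  block_ext_mulA block_ext_mul1 block_ext_mulr1 block_ext_mulDl block_ext_mulDr.

End BlockExtensionRing.

(* Main.v *)
(** The heredity chain of R is lifted to B = B(R; l) layer by layer.  Write J for
the radical of R.  An element of B is a matrix indexed by the pairs
(block, position), whose entry (p, q) lies in J unless p and q are in the same
block and p is not after q; its diagonal modulo J describes the radical and the
semisimple quotient of B.

Let H/I be a layer of the chain of R, so that H J H is contained in I, and let
K_k be the ideal of the elements of B with entries in H whose rows at a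
position >= k in a block i with e_i in H have entries in I.  Then K_k is B(H)
for large k.  Modulo K_k, the ideal K_(k+1) is generated as a right ideal by an
idempotent, the sum of the diagonal units of the rows at position k in these
blocks, so that K_(k+1)/K_k is projective.  The last layer, from K_1 down to
B(I), is the only one that uses the projectivity of H/I: the corner of B at the
first positions of all blocks is a copy of R, each row of K_1 is a copy of
e_i H (or zero modulo I), and maps out of such a row into a B-module X are the
same as R-linear maps from e_i H into the corresponding corner of X. *)
Require Import Defs.
From HB Require Import structures.
From mathcomp Require Import all_boot all_order all_algebra.
From mathcomp Require Import boolp classical_sets.

Set Implicit Arguments.
Unset Strict Implicit.
Unset Printing Implicit Defensive.

Import GRing.Theory.

Local Open Scope classical_set_scope.
Local Open Scope ring_scope.

(** * Ideals and radicals *)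

Section RightIdeals.
Context (R : pzRingType).
Implicit Types (A B M K : right_ideal R) (I H : ideal R) (x y : R).

Lemma right_ideal_ext A B : (A : set R) = B -> A = B.
Proof.
case: A B => [A A0 AB AM] [B B0 BB BM] /= AE; subst B.
by congr RightIdeal; apply: Prop_irrelevance.
Qed.

Lemma ideal_ext I H : (I : set R) = H -> I = H.
Proof.
case: I H => [I IM] [H HM] /= /right_ideal_ext E; subst H.
by congr Ideal; apply: Prop_irrelevance.
Qed.

Lemma right_ideal1 A x : A 1 -> A x.
Proof. by move=> A1; rewrite -[x]mul1r; apply: right_idealMr. Qed.

(** If [K] contains [M] and an [a] outside [M], then 1 is the sum of [1 - a * r] in [M] and [a * r]
    in [K]. *)
Lemma maximal_right_ideal_intro M : ~ M 1 ->
  (forall a, ~ M a -> exists r, M (1 - a * r)) -> maximal_right_ideal M.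
Proof.
move=> M1 MP; split; first by move=> MT; apply: M1; rewrite MT.
move=> K MK; case: (pselect (exists2 a, K a & ~ M a)) => [[a Ka Ma]|nK].
  right; apply/seteqP; split=> // x _; apply: right_ideal1.
  have [r Mr] := MP a Ma; rewrite -(subrK (a * r) 1).
  by apply: right_idealD; [apply: MK|apply: right_idealMr].
left; apply/seteqP; split=> // x Kx; apply: contrapT => Mx.
by apply: nK; exists x.
Qed.

End RightIdeals.

Section ToQuotient.
Context (R : pzRingType) (I : ideal R).
Implicit Types x y : R.

Lemma to_quotient1 : to_quotient I 1 = 1.
Proof. exact: rmorph1. Qed.

Lemma to_quotient0 : to_quotient I 0 = 0.
Proof. exact: rmorph0. Qed.

Lemma to_quotientB x y : to_quotient I (x - y) = to_quotient I x - to_quotient I y.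
Proof. exact: rmorphB. Qed.

Lemma to_quotientM x y : to_quotient I (x * y) = to_quotient I x * to_quotient I y.
Proof. exact: rmorphM. Qed.

Lemma to_quotient_eq0 x : to_quotient I x = 0 <-> I x.
Proof.
rewrite -to_quotient0.
by split=> [/to_quotientE|Ix]; [|apply/to_quotientE]; rewrite subr0.
Qed.

End ToQuotient.

Section GeneralRings.
Context (R : pzRingType).
Implicit Types (A B : set R) (I H : ideal R) (x y : R).

Lemma set_prod_mul A B x y : A x -> B y -> set_prod A B (x * y).
Proof.
by move=> Ax By; exists 1%N, (fun=> x), (fun=> y); split=> //; rewrite big_ord1.
Qed.

Lemma set_prod0 A B : set_prod A B 0.
Proof.
exists 0%N, (fun=> 0), (fun=> 0); split; try by case.
by rewrite big_ord0.
Qed.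

Lemma set_prodD A B x y : set_prod A B x -> set_prod A B y -> set_prod A B (x + y).
Proof.
move=> [k [a [b [Aa Bb ->]]]] [k' [a' [b' [Aa' Bb' ->]]]].
exists (k + k')%N, (fun i => match split i with inl j => a j | inr j => a' j end),
  (fun i => match split i with inl j => b j | inr j => b' j end).
split; try by move=> i; case: split.
rewrite big_split_ord /=; congr (_ + _); apply: eq_bigr => i _.
  by rewrite (unsplitK (inl i)).
by rewrite (unsplitK (inr i)).
Qed.

Lemma set_prod_elim A B (Q : R -> Prop) : Q 0 ->
  (forall x y, Q x -> Q y -> Q (x + y)) -> (forall x y, A x -> B y -> Q (x * y)) ->
  forall x, set_prod A B x -> Q x.
Proof.
move=> Q0 QD QM x [k [a [b [Aa Bb ->]]]].
by elim/big_ind: _ => // i _; apply: QM.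
Qed.

Lemma set_pow_ideal0 I k : set_pow I k 0.
Proof. by case: k => // k; apply: set_prod0. Qed.

Lemma set_pow_idealD I k x y : set_pow I k x -> set_pow I k y -> set_pow I k (x + y).
Proof. by case: k => // k; apply: set_prodD. Qed.

Lemma set_pow_idealMl I k r x : set_pow I k x -> set_pow I k (r * x).
Proof.
case: k => // k; move: x; apply: set_prod_elim.
- by rewrite mulr0; apply: set_prod0.
- by move=> x y; rewrite mulrDr; apply: set_prodD.
- by move=> x y Ix Iy; rewrite mulrA; apply: set_prod_mul => //; apply: idealMl.
Qed.

Lemma set_pow_ideal_le I j k x : (j <= k)%N -> set_pow I k x -> set_pow I j x.
Proof.
move/subnK <-; elim: (k - j)%N x => // i IH x; rewrite addSn => Ix; apply: IH.
move: x Ix; apply: set_prod_elim; first exact: set_pow_ideal0.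
  exact: set_pow_idealD.
by move=> x y _; apply: set_pow_idealMl.
Qed.

Lemma set_pow_expr A k x : A x -> set_pow A k (x ^+ k).
Proof.
move=> Ax; elim: k => // k IH; rewrite exprS; exact: set_prod_mul.
Qed.

Lemma nilpotent_inv1B x k : x ^+ k = 0 -> exists y, (1 - x) * y = 1.
Proof.
move=> xk0; exists (\sum_(i < k) x ^+ i).
by have := subrX1 x k; rewrite xk0 sub0r -[x - 1]opprB mulNr => /oppr_inj.
Qed.

(** A maximal right ideal missing [x] contains some [1 - x * r], which the geometric series makes
    right invertible. *)
Lemma nil_jacobson x : (forall r, exists k, (x * r) ^+ k = 0) -> jacobson R x.
Proof.
move=> nilx M mM; apply: contrapT => nMx.
have [m [r [Mm eq1]]] := maximal_right_idealP 1 mM nMx.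
have [k /nilpotent_inv1B[y]] := nilx r.
rewrite {1}eq1 addrK => my; case: mM => + _; apply.
apply/seteqP; split=> // z _; apply: right_ideal1.
by rewrite -my; apply: right_idealMr.
Qed.

Lemma jacobson_nilpotent x : nilpotent_set (jacobson R) -> jacobson R x ->
  exists k, x ^+ k = 0.
Proof.
move=> [k Jk] Jx; exists k; have := set_pow_expr k Jx; by rewrite Jk.
Qed.

(** The preimage in [R] of a maximal right ideal of the quotient is again maximal. *)
Lemma jacobson_quotient I x :
  jacobson R x -> jacobson (quotient_ring I) (to_quotient I x).
Proof.
move=> Jx M mM.
have pre0 : [set y | M (to_quotient I y)] 0.
  by rewrite /= to_quotient0; apply: right_ideal0.
have preB y z : [set y | M (to_quotient I y)] y -> [set y | M (to_quotient I y)] z ->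
    [set y | M (to_quotient I y)] (y - z).
  by rewrite /= to_quotientB; apply: right_idealB.
have preM y r : [set y | M (to_quotient I y)] y ->
    [set y | M (to_quotient I y)] (y * r).
  by rewrite /= to_quotientM; apply: right_idealMr.
apply: (Jx (RightIdeal pre0 preB preM)); apply: maximal_right_ideal_intro => /=.
  rewrite to_quotient1 => M1; case: mM => + _; apply.
  by apply/seteqP; split=> // y _; apply: right_ideal1.
move=> a Ma; have [m [r [Mm E]]] := maximal_right_idealP 1 mM Ma.
have [s sr] := to_quotient_surj r; exists s.
by rewrite to_quotientB to_quotientM to_quotient1 sr E addrK.
Qed.

(** The image of [M] in the quotient is maximal: as [I] lies in [M], membership in [M] can be tested
    on classes. *)
Lemma quotient_jacobson_maximal I (M : right_ideal R) x : maximal_right_ideal M ->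
  I `<=` M -> jacobson (quotient_ring I) (to_quotient I x) -> M x.
Proof.
move=> mM IM Jx; pose im := [set to_quotient I y | y in (M : set R)].
have imP y : im (to_quotient I y) -> M y.
  move=> [z Mz /to_quotientE /IM Mzy]; rewrite -[y](subKr z).
  exact: right_idealB.
have im0 : im 0 by exists 0; [apply: right_ideal0|rewrite to_quotient0].
have imB (y z : quotient_ring I) : im y -> im z -> im (y - z).
  move=> [a Ma <-] [b Mb <-]; exists (a - b); last by rewrite to_quotientB.
  exact: right_idealB.
have imM (y r : quotient_ring I) : im y -> im (y * r).
  move=> [a Ma <-]; have [s <-] := to_quotient_surj r.
  by exists (a * s); [apply: right_idealMr|rewrite to_quotientM].
apply/imP/(Jx (RightIdeal im0 imB imM)); apply: maximal_right_ideal_intro => /=.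
  rewrite -(to_quotient1 I) => /imP M1; case: mM => + _; apply.
  by apply/seteqP; split=> // y _; apply: right_ideal1.
move=> a ima; have [b ba] := to_quotient_surj a.
have nMb : ~ M b by move=> Mb; apply: ima; exists b.
have [m [r [Mm E]]] := maximal_right_idealP 1 mM nMb.
exists (to_quotient I r), m => //.
by rewrite -ba -(to_quotient1 I) -to_quotientM -to_quotientB E addrK.
Qed.

End GeneralRings.

(** * Peirce components and the radical *)

Section Peirce.
Context (R : pzRingType) (spR : semiprimary R).
Local Notation J := (jacobson R).
Implicit Types e f : idempotent_elt R.

Lemma jacobson_idempotent e : J e -> (e : R) = 0.
Proof.
case: spR => nilJ _ /(jacobson_nilpotent nilJ)[[|k]].
  by move/(congr1 (fun x => (e : R) * x)); rewrite mulr1 mulr0.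
suff -> : idempotent_val e ^+ k.+1 = idempotent_val e by [].
by elim: k => [|k IH]; rewrite ?expr1 // exprS IH idempotentP.
Qed.

(** The corner is local, and regular modulo [J]. With [x - x * y * x] in [J], either [x * y] is
    right invertible, hence so is [x], or [1 - x * y] has a right inverse [z]; then
    [x * y = (x - x * y * x) * (y * z)] is in [J], and so is [x]. *)
Lemma corner_unit e (x : corner e) : primitive_idempotent e -> ~ J (corner_val x) ->
  exists y, x * y = 1.
Proof.
move=> pe nJx; have [y Jy] := corner_regular spR x.
case: (corner_local spR pe (x * y)) => [[z xyz]|[z z1]].
  by exists (y * z); rewrite mulrA.
case: nJx; have Jxy : J (corner_val (x * y)).
  have -> : x * y = (x - x * y * x) * (y * z).
    rewrite mulrA mulrBl -[x * y * x * y]mulrA -[X in X - _]mulr1 -mulrBr.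
    by rewrite -(mulrA (x * y)) z1 mulr1.
  by rewrite corner_valM; apply: right_idealMr.
rewrite -[x](subrK (x * y * x)) corner_valD; apply: right_idealD => //.
by rewrite corner_valM; apply: right_idealMr.
Qed.

Lemma peirce_unit e x : primitive_idempotent e -> peirce e e x -> ~ J x ->
  exists2 y, peirce e e y & x * y = (e : R).
Proof.
move=> pe ex nJx; have [y xy] := @corner_unit e (to_corner ex) pe nJx.
by exists (corner_val y); [apply: cornerP|rewrite -[RHS]corner_val1 -xy].
Qed.

(** From left to right: the elements of the corner lying in [J] form a maximal right ideal, as all
    others are right invertible. The converse is the nil criterion. *)
Lemma corner_jacobsonE e x : primitive_idempotent e ->
  corner_jacobson e x <-> peirce e e x /\ J x.
Proof.
move=> pe; split=> [[y Jy <-]|[ex Jx]].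
  split; first exact: cornerP.
  pose L := [set z : corner e | J (corner_val z)].
  have L0 : L 0 by rewrite -[L 0]/(J (corner_val 0)) corner_val0; apply: right_ideal0.
  have LB u v : L u -> L v -> L (u - v).
    by rewrite -[L (u - v)]/(J (corner_val (u - v))) corner_valB; apply: right_idealB.
  have LM u v : L u -> L (u * v).
    by rewrite -[L (u * v)]/(J (corner_val (u * v))) corner_valM; apply: right_idealMr.
  apply: (Jy (RightIdeal L0 LB LM)); apply: maximal_right_ideal_intro => /=.
    by rewrite -[L 1]/(J (corner_val 1)) corner_val1 =>
      /jacobson_idempotent e0; case: pe.
  move=> a /(corner_unit pe)[r ar]; exists r; by rewrite ar subrr.
exists (to_corner ex) => //; apply: nil_jacobson => r.
by apply: (corner_nilp spR); rewrite corner_valM; apply: right_idealMr.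
Qed.

(** For every [r], the product [x * (f * r * e)] is in the radical of the corner at [e], hence in
    [J]. So the square of [x * r] is in [J], and [x * r] is nilpotent. *)
Lemma peirce_off_diagonal_jacobson e f x :
  primitive_idempotent e -> primitive_idempotent f ->
  ~ isomorphic_modules (right_ideal_module (principal (e : R)))
                       (right_ideal_module (principal (f : R))) ->
  peirce e f x -> J x.
Proof.
move=> pe pf nef efx; apply: nil_jacobson => r.
have Jxrx : J (x * r * x * r).
  have fer : peirce f e ((f : R) * r * (e : R)) by exists r.
  have := off_diagonal spR pe pf nef efx fer => /(corner_jacobsonE _ pe)[_].
  rewrite !mulrA (peirce_r efx) => Jxr.
  have -> : x * r * x * r = x * r * (e : R) * (x * r).
    by rewrite -!mulrA (mulrA (e : R)) (peirce_l efx).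
  exact: right_idealMr.
case: spR => nilJ _; have [k] := jacobson_nilpotent nilJ Jxrx.
by rewrite -mulrA -expr2 -exprM => ?; exists (2 * k)%N.
Qed.

End Peirce.

(** * Projectivity of a subquotient of the regular module *)

Section RelativeProjectivity.
Context (S : pzRingType) (I H : ideal S).
Hypothesis IH : I `<=` H.

(* Right (S/I)-linear maps H/I -> Y, seen as functions on S whose values
   outside H are irrelevant. *)
Definition rel_linear (Y : lmodType (quotient_ring I)^c) (phi : S -> Y) : Prop :=
  [/\ forall x y, H x -> H y -> phi (x + y) = phi x + phi y,
      forall x r, H x ->
        phi (x * r) = (to_quotient I r : (quotient_ring I)^c) *: phi x &
      forall x, I x -> phi x = 0].

(** Projectivity of [H/I] restated for functions on [S], so that later lifts are built without
    handling elements of the quotient module. *)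
Definition rel_projective : Prop :=
  forall (X Y : lmodType (quotient_ring I)^c) (g : {linear X -> Y}),
    (forall y, exists x, g x = y) ->
    forall phi, @rel_linear Y phi ->
    exists2 psi, @rel_linear X psi & forall x, H x -> g (psi x) = phi x.

Lemma rel_linear_sum (Y : lmodType (quotient_ring I)^c) (phi : S -> Y)
    (T : Type) (s : seq T) (P : pred T) (F : T -> S) :
  rel_linear phi -> (forall i, P i -> H (F i)) ->
  phi (\sum_(i <- s | P i) F i) = \sum_(i <- s | P i) phi (F i).
Proof.
move=> [phiD _ phi0] HF; elim: s => [|i s IHs].
  by rewrite !big_nil; apply/phi0/right_ideal0.
rewrite !big_cons; case: ifP => // Pi; rewrite phiD ?IHs //; first exact: HF.
exact: right_ideal_sum.
Qed.

Lemma rel_linear_eq (Y : lmodType (quotient_ring I)^c) (phi : S -> Y) x y :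
  rel_linear phi -> H y -> I (x - y) -> phi x = phi y.
Proof.
move=> [phiD _ phi0] Hy Ixy; rewrite -[x](subrK y) phiD //; last exact: IH.
by rewrite phi0 // add0r.
Qed.

Lemma rel_linear_comp (X Y : lmodType (quotient_ring I)^c) (g : {linear X -> Y}) phi :
  @rel_linear X phi -> @rel_linear Y (g \o phi).
Proof.
move=> [phiD phiM phi0]; split=> /= [x y Hx Hy|x r Hx|x Ix].
- by rewrite phiD // raddfD.
- by rewrite phiM // linearZ.
- by rewrite phi0 // raddf0.
Qed.

Local Notation M := (right_ideal_module (quotient_ideal I H)).

Let inM_subproof x (Hx : H x) : to_quotient I x \in (quotient_ideal I H : set _).
Proof. by apply/mem_set; exists x. Qed.

Let inM (x : S) : M :=
  if pselect (H x) is left Hx then RightIdealModule (inM_subproof Hx) else 0.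

Let inM_val x : H x -> right_ideal_val (inM x) = to_quotient I x.
Proof. by rewrite /inM; case: pselect. Qed.

Let liftM_subproof (m : M) : exists x, H x /\ inM x = m.
Proof.
case: m => m mP; have [x Hx xm] := set_mem mP; exists x; split=> //.
by apply: val_inj; rewrite /= inM_val.
Qed.

Let liftM m : S := sval (cid (liftM_subproof m)).

Let liftM_H m : H (liftM m). Proof. by rewrite /liftM; case: cid => x []. Qed.

Let liftMK m : inM (liftM m) = m. Proof. by rewrite /liftM; case: cid => x []. Qed.

Let inM_linear : rel_linear inM.
Proof.
split=> [x y Hx Hy|x r Hx|x Ix]; apply: val_inj.
- rewrite raddfD /= !inM_val // ?to_quotientD //; exact: right_idealD.
- by rewrite (linearZZ (val :
  M -> ((quotient_ring I)^c)^o)) /= !inM_val ?to_quotientM //; apply: right_idealMr.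
- by rewrite raddf0 /= inM_val; [apply/to_quotient_eq0|apply: IH].
Qed.

(** A [rel_linear] function is constant on classes modulo [I], so evaluating it at the chosen
    representative [liftM m] is linear in [m]. *)
Let descend (Y : lmodType (quotient_ring I)^c) (phi : S -> Y) : rel_linear phi ->
  exists h : {linear M -> Y}, forall x, H x -> h (inM x) = phi x.
Proof.
move=> phiL; have phiE x y : H x -> H y -> inM x = inM y -> phi x = phi y.
  move=> Hx Hy /(congr1 (@right_ideal_val _ _));
    rewrite !inM_val // => /to_quotientE Ixy.
  exact: rel_linear_eq.
have [phiD phiM phi0] := phiL; have [inD inMM _] := inM_linear.
pose h m := phi (liftM m).
have hl : linear h.
  move=> r x y; have [s sr] := to_quotient_surj r.
  rewrite /h -sr -phiM // -phiD //; last exact: right_idealMr.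
  apply: phiE => //; first by apply: right_idealD => //; apply: right_idealMr.
  by rewrite liftMK inD ?inMM ?liftMK //; apply: right_idealMr.
pose hL := GRing.isLinear.Build _ M Y *:%R h hl.
pose h' : {linear M -> Y} := HB.pack h hL.
by exists h' => x Hx /=; apply: phiE => //; rewrite liftMK.
Qed.

Lemma rel_projectiveP : projective_module M <-> rel_projective.
Proof.
split=> [projM X Y g gs phi phiL|proj X Y g f gs].
  have [f fE] := descend phiL; have [h hE] := projM X Y g f gs.
  by exists (h \o inM) => [|x Hx]; [apply: rel_linear_comp|rewrite /= hE fE].
have [psi psiL gpsi] := proj X Y g gs (f \o inM) (rel_linear_comp f inM_linear).
have [h hE] := descend psiL; exists h => p.
by rewrite -[p]liftMK hE // gpsi.
Qed.

(** Such a [u] is a left identity of [H] modulo [I], so its class generates [H/I], and one preimage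
    [x0] of [phi u] determines a lift of [phi]. *)
Lemma rel_projective_idempotent (u : S) : H u -> (forall x, H x -> I (x - u * x)) ->
  rel_projective.
Proof.
move=> Hu uP X Y g gs phi phiL; have [x0 gx0] := gs (phi u).
exists (fun x => (to_quotient I x : (quotient_ring I)^c) *: x0).
  split=> [x y _ _|x r _|x Ix].
  - by rewrite to_quotientD scalerDl.
  - by rewrite to_quotientM scalerA.
  - by rewrite (iffRL (to_quotient_eq0 I x)) // scale0r.
move=> x Hx; rewrite linearZ /= gx0; have [_ <- // _] := phiL.
apply/esym/(rel_linear_eq phiL); [exact: right_idealMr|exact: uP].
Qed.

(** Elements of the images lift, so the conditions can be checked on representatives in [S]. The
    radical remains that of the quotient ring, which need not be the image of the radical of [S]. *)
Lemma heredity_quotientP :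
  heredity_ideal (quotient_ideal I H) <->
  [/\ H `<=` [set x | exists2 y, set_prod H H y & I (x - y)],
      rel_projective &
      forall x y z, H x -> jacobson (quotient_ring I) (to_quotient I y) -> H z ->
        I (x * y * z)].
Proof.
have quotP A B x : set_prod (quotient_ideal I A) (quotient_ideal I B)
  (to_quotient I x) <->
    exists2 y, set_prod A B y & I (x - y).
  split=> [|[y]]; last first.
    move=> + /to_quotientE ->; move: y; apply: set_prod_elim.
    - by rewrite to_quotient0; apply: set_prod0.
    - by move=> y z; rewrite to_quotientD; apply: set_prodD.
    - by move=> a b Aa Bb; rewrite to_quotientM; apply: set_prod_mul;
      [exists a|exists b].
  move=> ABx; suff [y ABy] : exists2 y,
    set_prod A B y & to_quotient I x = to_quotient I y.
    by move/to_quotientE; exists y.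
  move: (to_quotient I x) ABx; apply: set_prod_elim.
  - by exists 0; rewrite ?to_quotient0 //; apply: set_prod0.
  - move=> _ _ [y yP ->] [z zP ->]; exists (y + z); last by rewrite to_quotientD.
    exact: set_prodD.
  - move=> _ _ [a Aa <-] [b Bb <-]; exists (a * b); last by rewrite to_quotientM.
    exact: set_prod_mul.
split=> [[HH /rel_projectiveP ? HJH]|[HH /rel_projectiveP ? HJH]]; split=> //.
- move=> x Hx; apply/quotP; rewrite HH; by exists x.
- move=> x y z Hx Jy Hz; apply/to_quotient_eq0.
  suff: [set (0 : quotient_ring I)] (to_quotient I (x * y * z)) by [].
  rewrite -HJH !to_quotientM; apply: set_prod_mul; last by exists z.
  by apply: set_prod_mul => //; exists x.
- apply/seteqP; split=> [|y].
    apply: set_prod_elim; [exact: right_ideal0|exact: right_idealD|].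
    by move=> x y Hx _; apply: right_idealMr.
  by move=> [x Hx <-]; apply/quotP; apply: HH.
- apply/seteqP; split=> [|_ ->]; last exact: set_prod0.
  apply: set_prod_elim => //=; first by move=> x y -> ->; rewrite addr0.
  move=> x _ + [z Hz <-]; move: x; apply: set_prod_elim; first by rewrite mul0r.
    by move=> x y xz yz; rewrite mulrDl xz yz addr0.
  move=> _ y [x Hx <-]; have [{}y <-] := to_quotient_surj y => Jy.
  rewrite -(to_quotientM I x y) -to_quotientM; apply/to_quotient_eq0; exact: HJH.
Qed.

End RelativeProjectivity.

(* As rho need not preserve the identity, restricting scalars along it yields a
   unital module only on the part of X fixed by rho 1. *)
Section RestrictionOfScalars.
Context (R S : pzRingType) (rho : R -> S).
Definition restriction_data : Prop :=
  {morph rho : x y / x + y} /\ {morph rho : x y / x * y}.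

Record restriction (h : restriction_data) (X : lmodType S) := Restriction {
  restriction_val : X;
  _ : rho 1 *: restriction_val == restriction_val
}.

Section Module.
Context (h : restriction_data) (X : lmodType S).
Local Notation X' := (restriction h X).
Let rhoD : {morph rho : x y / x + y} := proj1 h.
Let rhoM : {morph rho : x y / x * y} := proj2 h.

HB.instance Definition _ := [isSub of X' for @restriction_val h X].
HB.instance Definition _ := [Choice of X' by <:].

Fact restriction_zmod_closed : zmod_closed (fun x : X => rho 1 *: x == x).
Proof.
split=> [|x y]; rewrite -!topredE /= ?scaler0 // => /eqP xE /eqP yE.
by rewrite scalerBr xE yE.
Qed.

HB.instance Definition _ := GRing.SubChoice_isSubZmodule.Build X
  (fun x : X => rho 1 *: x == x) X' restriction_zmod_closed.

Fact restriction_valP (x : X') : rho 1 *: restriction_val x = restriction_val x.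
Proof. by case: x => x /= /eqP. Qed.

Fact restriction_scale_subproof (r : R) (x : X') :
  rho 1 *: (rho r *: restriction_val x) == rho r *: restriction_val x.
Proof. by rewrite scalerA -rhoM mul1r. Qed.

Definition restriction_scale r x : X' := Restriction h (restriction_scale_subproof r x).

Fact restriction_valD (x y : X') :
  restriction_val (x + y) = restriction_val x + restriction_val y.
Proof. exact: (raddfD (val : X' -> X)). Qed.

Fact restriction_scaleA a b x :
  restriction_scale a (restriction_scale b x) = restriction_scale (a * b) x.
Proof. by apply: val_inj; rewrite /= scalerA rhoM. Qed.

Fact restriction_scale1 : left_id 1 restriction_scale.
Proof. by move=> x; apply: val_inj; apply: restriction_valP. Qed.

Fact restriction_scaleDr : right_distributive restriction_scale +%R.
Proof.
move=> r x y; apply: val_inj.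
by rewrite [RHS]restriction_valD -[LHS]/(rho r *: restriction_val (x + y))
  restriction_valD scalerDr.
Qed.

Fact restriction_scaleDl x : {morph restriction_scale^~ x : a b / a + b}.
Proof. by move=> a b; apply: val_inj;
  rewrite [RHS]restriction_valD /= rhoD scalerDl. Qed.

HB.instance Definition _ := GRing.Zmodule_isLmodule.Build R X'
  restriction_scaleA restriction_scale1 restriction_scaleDr restriction_scaleDl.

Fact restriction_valZ r (x : X') : restriction_val (r *: x) = rho r *:
  restriction_val x.
Proof. by []. Qed.

End Module.
Section Map.
Context (h : restriction_data) (X Y : lmodType S) (g : {linear X -> Y}).

Fact restriction_map_subproof (x : restriction h X) :
  rho 1 *: g (restriction_val x) == g (restriction_val x).
Proof. by rewrite -linearZ /= restriction_valP. Qed.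

Definition restriction_map x : restriction h Y :=
  Restriction h (restriction_map_subproof x).

Fact restriction_map_is_linear : linear restriction_map.
Proof.
move=> r x y; apply: val_inj; rewrite [RHS]restriction_valD restriction_valZ.
by rewrite -[LHS]/(g (restriction_val (r *: x + y)))
  restriction_valD restriction_valZ linearP.
Qed.

HB.instance Definition _ :=
  GRing.isLinear.Build R (restriction h X) (restriction h Y) *:%R
  restriction_map restriction_map_is_linear.

(** A preimage need not be fixed by [rho 1], but its multiple by [rho 1] is, and has the same
    image. *)
Lemma restriction_map_surj : (forall y, exists x, g x = y) ->
  forall y, exists x, restriction_map x = y.
Proof.
move=> gs y; have [x gx] := gs (restriction_val y).
have xP : rho 1 *: (rho 1 *: x) == rho 1 *: x.
  by rewrite scalerA -(proj2 h) mulr1.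
exists (Restriction h xP); apply: val_inj.
by rewrite /= linearZ /= gx restriction_valP.
Qed.

End Map.
End RestrictionOfScalars.

(** * Lifting along a ring map that need not preserve 1 *)

Section RelProjectiveNonunital.
Context (S Q : pzRingType) (I H : ideal S) (rho : S -> Q).
Hypothesis IH : I `<=` H.
Hypothesis rhoD : {morph rho : x y / x + y}.
Hypothesis rhoM : {morph rho : x y / x * y}.
Hypothesis rho0 : forall x, I x -> rho x = 0.

Definition nonunital_linear (Y : lmodType Q^c) (phi : S -> Y) : Prop :=
  [/\ forall x y, H x -> H y -> phi (x + y) = phi x + phi y,
      forall x r, H x -> phi (x * r) = (rho r : Q^c) *: phi x &
      forall x, I x -> phi x = 0].

Lemma nonunital_linear_sum (Y : lmodType Q^c) (phi : S -> Y) (T : Type) (s : seq T)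
    (P : pred T) (F : T -> S) : nonunital_linear phi -> (forall i, P i -> H (F i)) ->
  phi (\sum_(i <- s | P i) F i) = \sum_(i <- s | P i) phi (F i).
Proof.
move=> [phiD _ phi0] HF; elim: s => [|i s IHs].
  by rewrite !big_nil; apply/phi0/right_ideal0.
rewrite !big_cons; case: ifP => // Pi; rewrite phiD ?IHs //; first exact: HF.
exact: right_ideal_sum.
Qed.

Let rhoq (x : (quotient_ring I)^c) : Q^c := rho (quotient_repr x).

Let rhoqE x : rhoq (to_quotient I x) = rho x.
Proof.
rewrite /rhoq -[in RHS](subrK (quotient_repr (to_quotient I x)) x) rhoD.
rewrite [rho (x - _)]rho0 ?add0r //; apply/to_quotientE.
by rewrite quotient_reprK.
Qed.

Let rhoq_data : restriction_data rhoq.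
Proof.
split=> x y; have [a <-] := to_quotient_surj x; have [b <-] := to_quotient_surj y.
  by rewrite -[to_quotient I a + _]to_quotientD !rhoqE rhoD.
by rewrite -[_ * _]/(to_quotient I b * to_quotient I a) -to_quotientM !rhoqE rhoM.
Qed.

(** As [phi x = phi (x * 1)], the values of [phi] on [H] are fixed by [rho 1], so the lifting takes
    place between the restricted modules, which are unital. *)
Lemma rel_projective_nonunital : rel_projective I H ->
  forall (X Y : lmodType Q^c) (g : {linear X -> Y}), (forall y, exists x, g x = y) ->
  forall phi, @nonunital_linear Y phi ->
    exists2 psi, @nonunital_linear X psi & forall x, H x -> g (psi x) = phi x.
Proof.
move=> proj X Y g gs phi [phiD phiM phi0].
have phiP x : H x -> rhoq 1 *: phi x == phi x.
  by move=> Hx; rewrite -[1]to_quotient1 rhoqE -phiM // mulr1.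
pose phi' x : restriction rhoq_data Y :=
  if pselect (H x) is left Hx then Restriction rhoq_data (phiP x Hx) else 0.
have phi'E x : H x -> restriction_val (phi' x) = phi x by rewrite /phi'; case: pselect.
have phi'L : @rel_linear _ I H _ phi'.
  split=> [x y Hx Hy|x r Hx|x Ix]; apply: val_inj.
  - by rewrite [RHS]restriction_valD /= !phi'E ?phiD //; apply: right_idealD.
  - by rewrite [RHS]restriction_valZ /= !phi'E ?phiM ?rhoqE //; apply: right_idealMr.
  - by rewrite /= phi'E ?phi0 //; apply: IH.
have [psi [psiD psiM psi0] psiE] :=
  proj _ _ (@restriction_map _ _ _ rhoq_data X Y g) (restriction_map_surj gs)
    phi' phi'L.
exists (fun x => restriction_val (psi x)) => [|x Hx].
  split=> [x y Hx Hy|x r Hx|x Ix].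
  - by rewrite psiD // restriction_valD.
  - by rewrite psiM // restriction_valZ rhoqE.
  - by rewrite psi0.
by rewrite -phi'E // -psiE.
Qed.

End RelProjectiveNonunital.

(** * Entries of a block extension *)

Section BlockExtensionEntries.
Context (R : pzRingType) (n : nat) (e : 'I_n -> idempotent_elt R).
Context (spR : semiprimary R) (comp_e : complete_primitive_orthogonal e).
Context (basic_e : basic_idempotents e) (l : 'I_n -> nat).

Local Notation B := (block_extension spR comp_e basic_e l).
Local Notation J := (jacobson R).
Local Notation index := 'I_(\sum_(i < n) l i).
Implicit Types (p q r : index) (X Y : B) (x y : R).

Definition blk p : 'I_n := tagnat.sig1 p.
Definition pos p : nat := tagnat.sig2 p.
Definition idem_at p : R := e (blk p).
Local Notation idp := idem_at.

Lemma blk_pos_inj p q : blk p = blk q -> pos p = pos q -> p = q.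
Proof.
move=> b c; apply: val_inj => /=; rewrite -[p]tagnat.sig2K -[q]tagnat.sig2K.
by apply/eqP; rewrite tagnat.eq_Rank; apply/andP; split; apply/eqP.
Qed.

Lemma blk_Rank i (j : 'I_(l i)) : blk (tagnat.Rank i j) = i.
Proof. exact: tagnat.Rank1K. Qed.

Lemma pos_Rank i (j : 'I_(l i)) : pos (tagnat.Rank i j) = j.
Proof. by rewrite /pos tagnat.Rank2K. Qed.

Lemma pos_lt p : (pos p < (\sum_(i < n) l i).+1)%N.
Proof.
rewrite ltnS; apply: leq_trans (ltnW (ltn_ord (tagnat.sig2 p))) _.
by rewrite (bigD1 (blk p)) //= leq_addr.
Qed.

Lemma idem_at_idem p : idp p * idp p = idp p.
Proof. exact: idempotentP. Qed.

Lemma idem_at_prim p : primitive_idempotent (e (blk p)).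
Proof. by case: comp_e. Qed.

Lemma idem_at_neq0 p : idp p <> 0.
Proof. by case: (idem_at_prim p). Qed.

Lemma idem_at_orth p q : blk p != blk q -> idp p * idp q = 0.
Proof. by case: comp_e => _ + _; apply. Qed.

Lemma idem_at_jacobson p : ~ J (idp p).
Proof. by move/(jacobson_idempotent spR)/idem_at_neq0. Qed.

(** One condition for the three cases of [block_entry]: between different blocks, lying in [J] is
    automatic because [R] is basic. *)
Definition entry_shape p q x :=
  peirce (e (blk p)) (e (blk q)) x /\
  (~~ ((blk p == blk q) && (pos p <= pos q)%N) -> J x).

Lemma block_entryE i s j t x : block_entry e i s j t x <->
  peirce (e i) (e s) x /\ (~~ ((i == s) && (j <= t)%N) -> J x).
Proof.
have [pe _ _] := comp_e; rewrite /block_entry; case: eqP => [<-|/eqP nis] /=.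
  case: leqP => jt /=; first by split=> // -[].
  rewrite corner_jacobsonE //; by split=> -[? Jx]; split=> //; apply: Jx.
split=> [ex|[]//]; split=> // _.
exact: (peirce_off_diagonal_jacobson spR (pe i) (pe s) (basic_e nis)).
Qed.

Lemma block_setP (A : 'M[R]_(\sum_(i < n) l i)) :
  block_set e l A <-> forall p q, entry_shape p q (A p q).
Proof.
split=> [hA p q|hA i s j t].
  have := hA (blk p) (blk q) (tagnat.sig2 p) (tagnat.sig2 q).
  by rewrite mxE !tagnat.sig2K => /block_entryE.
apply/block_entryE; rewrite mxE; have := hA (tagnat.Rank i j) (tagnat.Rank s t).
by rewrite /entry_shape !blk_Rank !pos_Rank.
Qed.

Definition ent X p q : R := block_val X p q.

Lemma ent_inj X Y : (forall p q, ent X p q = ent Y p q) -> X = Y.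
Proof. by move=> XY; apply: val_inj; apply/matrixP. Qed.

Lemma entP X p q : entry_shape p q (ent X p q).
Proof. by have /block_setP := blockP X; apply. Qed.

Lemma entJ X p q : ~~ ((blk p == blk q) && (pos p <= pos q)%N) -> J (ent X p q).
Proof. by case: (entP X p q). Qed.

Lemma ent_idl X p q : idp p * ent X p q = ent X p q.
Proof. by case: (entP X p q) => /peirce_l. Qed.

Lemma ent_idr X p q : ent X p q * idp q = ent X p q.
Proof. by case: (entP X p q) => /peirce_r. Qed.

Lemma entM X Y p q : ent (X * Y) p q = \sum_r ent X p r * ent Y r q.
Proof. by rewrite /ent mxE. Qed.

Lemma entB X Y p q : ent (X - Y) p q = ent X p q - ent Y p q.
Proof.
have -> : ent (X - Y) p q = (block_val X - block_val Y) p q.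
  by congr (fun_of_matrix _ p q); apply: (raddfB (val : B -> _)).
by rewrite !mxE.
Qed.

Lemma ent0 p q : ent 0 p q = 0.
Proof.
have -> : ent 0 p q = (0 : 'M[R]_(\sum_(i < n) l i)) p q.
  by congr (fun_of_matrix _ p q); apply: (raddf0 (val : B -> _)).
by rewrite mxE.
Qed.

Lemma entD X Y p q : ent (X + Y) p q = ent X p q + ent Y p q.
Proof. by rewrite /ent block_ext_valD mxE. Qed.

Lemma ent_sum (T : Type) (s : seq T) (P : pred T) (F : T -> B) p q :
  ent (\sum_(i <- s | P i) F i) p q = \sum_(i <- s | P i) ent (F i) p q.
Proof.
exact: (big_morph (fun X => ent X p q) (fun X Y => entD X Y p q) (ent0 p q)).
Qed.

(* Junk value 0 when F does not define an element of the block extension. *)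
Definition block_of_fun (F : index -> index -> R) : B :=
  insubd (0 : B) (\matrix_(p, q) F p q).

Lemma block_of_funE F p q :
  (forall p q, entry_shape p q (F p q)) -> ent (block_of_fun F) p q = F p q.
Proof.
move=> FP; rewrite /ent /block_of_fun val_insubd ifT ?mxE //.
by apply/mem_set/block_setP => {}p {}q; rewrite mxE.
Qed.

Lemma shape0 p q : entry_shape p q 0.
Proof. by split=> [|_]; [apply: peirce0|apply: right_ideal0]. Qed.

Definition single p q x : B :=
  block_of_fun (fun p' q' => if (p' == p) && (q' == q) then x else 0).

Lemma ent_single p q x p' q' : entry_shape p q x ->
  ent (single p q x) p' q' = if (p' == p) && (q' == q) then x else 0.
Proof.
move=> px; rewrite block_of_funE // => {}p' {}q';
  case: ifP => [/andP[/eqP-> /eqP->]//|_].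
exact: shape0.
Qed.

Lemma ent_mul_single X p q x p' q' : entry_shape p q x ->
  ent (X * single p q x) p' q' = if q' == q then ent X p' p * x else 0.
Proof.
move=> px; rewrite entM (bigD1 p) //= ent_single // eqxx /= [X in _ + X]big1 ?addr0.
  by case: ifP => // _; rewrite mulr0.
by move=> r rp; rewrite ent_single // (negPf rp) mulr0.
Qed.

Lemma ent_single_mul X p q x p' q' : entry_shape p q x ->
  ent (single p q x * X) p' q' = if p' == p then x * ent X q q' else 0.
Proof.
move=> px; rewrite entM (bigD1 q) //= ent_single // eqxx andbT [X in _ + X]big1 ?addr0.
  by case: ifP => // _; rewrite mul0r.
by move=> r rp; rewrite ent_single // (negPf rp) andbF mul0r.
Qed.

Lemma single_decomposition X : X = \sum_p \sum_q single p q (ent X p q).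
Proof.
apply: ent_inj => p q; rewrite ent_sum (bigD1 p) //= ent_sum (bigD1 q) //=.
rewrite ent_single ?eqxx; last exact: entP.
rewrite [X in _ + X + _]big1 ?addr0 => [|r rq]; last first.
  by rewrite ent_single ?[q == r]eq_sym ?(negPf rq) ?andbF //; apply: entP.
rewrite [X in _ + X]big1 ?addr0 // => r rp; rewrite ent_sum [LHS]big1 // => s _.
by rewrite ent_single 1?[p == r]eq_sym ?(negPf rp) //; apply: entP.
Qed.

Lemma shape_idem_at p : entry_shape p p (idp p).
Proof. by split; [apply: peirce_id|rewrite eqxx leqnn]. Qed.

Definition diag_unit p : B := single p p (idp p).

Lemma ent_diag_unit_mul p X p' q :
  ent (diag_unit p * X) p' q = if p' == p then ent X p q else 0.
Proof. by rewrite ent_single_mul ?ent_idl //; apply: shape_idem_at. Qed.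

Lemma ent_mul_diag_unit p X p' q :
  ent (X * diag_unit p) p' q = if q == p then ent X p' p else 0.
Proof. by rewrite ent_mul_single ?ent_idr //; apply: shape_idem_at. Qed.

Lemma ent_diag_unit p p' q :
  ent (diag_unit p) p' q = if (p' == p) && (q == p) then idp p else 0.
Proof. by rewrite ent_single //; apply: shape_idem_at. Qed.

Lemma ent1 p : ent 1 p p = idp p.
Proof. by have := ent_diag_unit_mul p 1 p p; rewrite mulr1 eqxx ent_diag_unit eqxx. Qed.

(** An entry of the local corner outside [J] is right invertible there; [Y] carries the inverse at
    [(p, p)] and is 0 elsewhere. Hence an ideal containing [X] contains [diag_unit p]. *)
Lemma ent_unit X p : ~ J (ent X p p) ->
  exists2 Y, ent (X * Y) p p = idp p &
    (diag_unit p * X * Y * diag_unit p = diag_unit p) /\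
    forall p' q, q != p -> ent Y p' q = 0.
Proof.
move=> nJ; have [ex _] := entP X p p.
have [y ey xy] := peirce_unit spR (idem_at_prim p) ex nJ.
have sy : entry_shape p p y by split=> //; rewrite eqxx leqnn.
have XY : ent (X * single p p y) p p = idp p by rewrite ent_mul_single // eqxx.
exists (single p p y) => //; split; last first.
  by move=> p' q qp; rewrite ent_single // (negPf qp) andbF.
apply: ent_inj => p' q;
  rewrite ent_mul_diag_unit -mulrA ent_diag_unit_mul XY ent_diag_unit.
by case: (p' == p); case: (q == p).
Qed.

Lemma entM_diag X Y p : J (ent (X * Y) p p - ent X p p * ent Y p p).
Proof.
rewrite entM (bigD1 p) //= addrAC subrr add0r.
apply: (right_ideal_sum (A := J)) => r rp.
case: (boolP ((blk p == blk r) && (pos p <= pos r)%N)) => [/andP[/eqP b c]|pr];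
  last first.
  exact/right_idealMr/entJ.
apply/idealMl/entJ; apply/negP => /andP[_ c']; case/eqP: rp.
by apply: blk_pos_inj => //; apply/eqP; rewrite eqn_leq c' c.
Qed.

End BlockExtensionEntries.

(** * The radical of a block extension *)

Section BlockExtensionRadical.
Context (R : pzRingType) (n : nat) (e : 'I_n -> idempotent_elt R).
Context (spR : semiprimary R) (comp_e : complete_primitive_orthogonal e).
Context (basic_e : basic_idempotents e) (l : 'I_n -> nat).

Local Notation B := (block_extension spR comp_e basic_e l).
Local Notation J := (jacobson R).
Local Notation index := 'I_(\sum_(i < n) l i).
Implicit Types (p q r : index) (X Y : B) (x y : R).

Definition diag_set p : set B := [set X | J (ent X p p)].

Fact diag_set0 p : diag_set p 0.
Proof. by rewrite /diag_set /= ent0; apply: jacobson0. Qed.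

Fact diag_setB p X Y : diag_set p X -> diag_set p Y -> diag_set p (X - Y).
Proof. by rewrite /diag_set /= entB; apply: jacobsonB. Qed.

Fact diag_setM p X Y : diag_set p X -> diag_set p (X * Y).
Proof.
rewrite /diag_set /= => JX; rewrite -[ent _ _ _](subrK (ent X p p * ent Y p p)).
by apply: (right_idealD (A := J)); [apply: entM_diag|apply: jacobsonMr].
Qed.

Definition diag_ideal p : right_ideal B :=
  RightIdeal (@diag_set0 p) (@diag_setB p) (@diag_setM p).

Lemma diag_ideal_maximal p : maximal_right_ideal (diag_ideal p).
Proof.
apply: maximal_right_ideal_intro => [|X nX] /=.
  by rewrite /diag_set /= ent1; apply: idem_at_jacobson.
have [Y XY _] := ent_unit nX; exists Y.
by rewrite /diag_set /= entB ent1 XY subrr; apply: jacobson0.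
Qed.

Lemma diag_ideal_contains (K : ideal B) p :
  ~ K (diag_unit _ _ _ p) -> K `<=` diag_ideal p.
Proof.
move=> nKp X KX; apply: contrapT => nX; have [Y _ [E _]] := ent_unit nX.
by apply: nKp; rewrite -E -!mulrA; apply/idealMl/right_idealMr.
Qed.

(** Since [K] lies in the maximal right ideal [diag_ideal p], that ideal stays maximal in the
    quotient by [K]. *)
Lemma quotient_jacobson_diag (K : ideal B) X p : ~ K (diag_unit _ _ _ p) ->
  jacobson (quotient_ring K) (to_quotient K X) -> J (ent X p p).
Proof.
move=> nKp.
exact: quotient_jacobson_maximal (diag_ideal_maximal p) (diag_ideal_contains nKp).
Qed.

Let L := (\sum_(i < n) l i).+1.

(* Inside a block, a step that is not in J moves to a strictly later position,
   so at least one step in L consecutive ones is in J. *)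
Lemma diag_pow_ent k X : set_pow [set X | forall p, diag_set p X] k X ->
  forall p q, set_pow J ((k + pos p) %/ L) (ent X p q).
Proof.
elim: k X => [|k IH] X.
  by move=> _ p q; rewrite add0n divn_small //; apply: pos_lt.
move: X; apply: set_prod_elim => [p q|X Y NX NY p q|X Y NX NY p q].
- by rewrite ent0; apply: set_pow_ideal0.
- by rewrite entD; apply: set_pow_idealD.
rewrite entM; elim/big_ind: _ => //; first exact: set_pow_ideal0.
  exact: set_pow_idealD.
move=> r _; have JY := IH Y NY r q.
(* A move forward inside a block gives no factor in [J], but the larger position makes up for the
   step used. *)
case: (boolP ((blk p == blk r) && (pos p < pos r)%N)) => [/andP[_ pr]|pr].
  apply/set_pow_idealMl/(set_pow_ideal_le _ JY)/leq_div2r.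
  by rewrite addSnnS leq_add2l.
have JX : J (ent X p r).
  have [b|nb] := eqVneq (blk p) (blk r); last by apply: entJ; rewrite (negPf nb).
  have [c|nc] := eqVneq (pos p) (pos r).
    by rewrite -(blk_pos_inj b c); apply: NX.
  apply: entJ; move: pr; rewrite b eqxx /= -leqNgt -ltnNge ltn_neqAle => ->.
  by rewrite eq_sym nc.
(* A factor in [J] adds [L] to the numerator, which covers any loss of position since
   [pos p < L]. *)
apply: (@set_pow_ideal_le _ _ _ ((k + pos r) %/ L).+1); last exact: set_prod_mul.
have -> : ((k + pos r) %/ L).+1 = ((k + pos r + L) %/ L)%N.
  by rewrite (divnDr _ (dvdnn L)) divnn addn1.
apply: leq_div2r; rewrite addSnnS -addnA leq_add2l;
  apply: leq_trans (leq_addl _ _); exact: pos_lt.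
Qed.

(** One direction is the maximality of [diag_ideal p]. For the other, if [J^m = 0], then the power
    of [X * Y] with exponent [m * L] has its entries in [J^m]. *)
Lemma jacobson_blockP X : jacobson B X <-> forall p, J (ent X p p).
Proof.
split=> [JX p|JX]; first exact: (JX _ (diag_ideal_maximal p)).
apply: nil_jacobson => Y; have [[m Jm] _] := spR.
exists (m * L)%N; apply: ent_inj => p q; rewrite ent0.
have : set_pow J (m * L %/ L) (ent ((X * Y) ^+ (m * L)) p q).
  have := @diag_pow_ent (m * L) ((X * Y) ^+ (m * L)).
  move=> /(_ _ p q) H; apply: set_pow_ideal_le (H _).
    by apply: leq_div2r; apply: leq_addr.
  apply: (@set_pow_expr _ [set X | forall p, diag_set p X]) => r; exact/diag_setM/JX.
by rewrite mulnK // Jm.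
Qed.

Lemma nilpotent_jacobson_block : nilpotent_set (jacobson B).
Proof.
have [[m Jm] _] := spR; exists (m * L)%N; apply/seteqP; split=> [X|_ ->]; last first.
  exact: set_pow_ideal0.
have -> : (jacobson B : set B) = [set X | forall p, diag_set p X].
  by apply/seteqP; split=> Y /jacobson_blockP.
move=> /diag_pow_ent NX; apply: ent_inj => p q; rewrite ent0.
suff : set_pow J m (ent X p q) by rewrite Jm.
apply: set_pow_ideal_le (NX p q); rewrite -{1}(@mulnK m L) //.
by apply: leq_div2r; apply: leq_addr.
Qed.

(** Modulo the radical only the diagonal survives, with entries in division rings. A right ideal [A]
    is thus determined by the set [T] of diagonal units it contains; its complement [C] consists of
    the classes vanishing on [T]. *)
Lemma semisimple_block : semisimple_ring (quotient_ring (jacobson B)).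
Proof.
set pi := to_quotient (jacobson B) => A.
pose T p : Prop := A (pi (diag_unit _ _ _ p)).
pose C := [set y | exists2 X, y = pi X & forall p, T p -> J (ent X p p)].
have C0 : C 0.
  by exists 0 => [|p _]; [rewrite /pi to_quotient0|rewrite ent0; apply: jacobson0].
have CB (x y : quotient_ring (jacobson B)) : C x -> C y -> C (x - y).
  move=> [X -> XT] [Y -> YT]; exists (X - Y); first by rewrite /pi to_quotientB.
  by move=> p Tp; rewrite entB; apply: jacobsonB; [apply: XT|apply: YT].
have CM (x y : quotient_ring (jacobson B)) : C x -> C (x * y).
  move=> [X -> XT]; have [Y <-] := to_quotient_surj y.
  exists (X * Y); first by rewrite /pi to_quotientM.
  by move=> p Tp; apply: (@diag_setM p); apply: XT.
exists (RightIdeal C0 CB CM); split.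
  apply/seteqP; split=> [y [/= Ay [X Xy XT]]|_ ->]; last first.
    by split; apply: right_ideal0.
  rewrite Xy; apply/to_quotient_eq0/jacobson_blockP => p.
  (* An entry outside [J] at [(p, p)] puts [p] in [T]: multiplying by [Y] yields [diag_unit p]
     modulo the radical. *)
  apply: contrapT => nX; have [Y XY [_ Yq]] := ent_unit nX.
  apply/nX/XT; rewrite /T.
  have -> : pi (diag_unit _ _ _ p) = pi (X * Y).
    apply/to_quotientE/jacobson_blockP => q; rewrite entB ent_diag_unit.
    have [->|qp] := eqVneq q p; first by rewrite XY subrr; apply: jacobson0.
    rewrite entM big1 ?subr0; first exact: jacobson0.
    by move=> r _; rewrite Yq // mulr0.
  by rewrite /pi to_quotientM -/pi -Xy; apply: right_idealMr.
move=> y; have [X <-] := to_quotient_surj y; rewrite -/pi.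
pose u := \sum_(p | `[< T p >]) diag_unit spR comp_e basic_e p.
exists (pi (u * X)), (pi (X - u * X)); split; last first.
- by rewrite /pi to_quotientB addrC subrK.
- exists (X - u * X) => // p Tp; rewrite entB /u mulr_suml ent_sum.
  rewrite (bigD1 p) /=; last exact/asboolP.
  rewrite ent_diag_unit_mul eqxx [X in _ - (_ + X)]big1 ?addr0 ?subrr;
    first exact: jacobson0.
  by move=> q /andP[_ qp]; rewrite ent_diag_unit_mul eq_sym (negPf qp).
rewrite /pi to_quotientM; apply: right_idealMr; rewrite /u.
rewrite (raddf_sum (to_quotient (jacobson B))).
by apply: right_ideal_sum => p /asboolP.
Qed.

Lemma semiprimary_block : semiprimary B.
Proof. by split; [apply: nilpotent_jacobson_block|apply: semisimple_block]. Qed.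

End BlockExtensionRadical.

(** * Layers of a heredity chain *)

Section HeredityLayer.
Context (R : pzRingType) (n : nat) (e : 'I_n -> idempotent_elt R).
Context (spR : semiprimary R) (comp_e : complete_primitive_orthogonal e).
Context (basic_e : basic_idempotents e).
Context (I H : ideal R).
Hypothesis IH : I `<=` H.
Hypothesis hered : heredity_ideal (quotient_ideal I H).
Local Notation J := (jacobson R).

Lemma layer_jacobson x y z : H x -> J y -> H z -> I (x * y * z).
Proof.
have [_ _ HJH] := (heredity_quotientP IH).1 hered.
by move=> Hx Jy Hz; apply: HJH => //; apply: jacobson_quotient.
Qed.

(** The ideal generated by [I] and the [e i] lying in [H], in a form that allows induction on its
    elements. *)
Inductive layer_trace : R -> Prop :=
  | LayerTraceIdem i (x y : R) : H (e i) -> layer_trace (x * (e i : R) * y)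
  | LayerTraceI x : I x -> layer_trace x
  | LayerTraceD x y : layer_trace x -> layer_trace y -> layer_trace (x + y).

Lemma layer_trace_mul r s x : layer_trace x -> layer_trace (r * x * s).
Proof.
elim=> {x} [i x y Hi|x Ix|x y _ xs _ ys].
- by rewrite !mulrA -(mulrA _ y s); apply: LayerTraceIdem.
- by apply: LayerTraceI; apply/right_idealMr/idealMl.
- by rewrite mulrDr mulrDl; apply: LayerTraceD.
Qed.

(** Outside [J], [x] would be right invertible in the corner, forcing [e i] into [H]. *)
Lemma peirce_layer_jacobson i x : ~ H (e i) -> H x -> peirce (e i) (e i) x -> J x.
Proof.
have [pe _ _] := comp_e.
move=> nHi Hx ex; apply: contrapT => nJx.
have [y _ xy] := peirce_unit spR (pe i) ex nJx.
by apply: nHi; rewrite -xy; apply: right_idealMr.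
Qed.

(** Peirce components between different idempotents are in [J]; a diagonal one is in [J] unless its
    [e i] is in [H]. *)
Lemma layer_trace_mod_jacobson x : H x -> exists2 j, J j & layer_trace (x - j).
Proof.
have [pe _ e1] := comp_e; move=> Hx.
have -> : x = \sum_i \sum_s (e i : R) * x * (e s : R).
  rewrite -{1}[x]mulr1 -{1}[x]mul1r -e1 !mulr_suml; apply: eq_bigr => i _.
  by rewrite mulr_sumr.
have JQ y : J y -> exists2 j, J j & layer_trace (y - j).
  by exists y => //; rewrite subrr; apply/LayerTraceI/right_ideal0.
have QD y z : (exists2 j, J j & layer_trace (y - j)) ->
   (exists2 j, J j & layer_trace (z - j)) -> exists2 j, J j & layer_trace (y + z - j).
  move=> [j Jj yj] [k Jk zk]; exists (j + k); first exact: right_idealD.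
  by rewrite opprD addrACA; apply: LayerTraceD.
have Q0 : exists2 j, J j & layer_trace (0 - j) by apply/JQ/right_ideal0.
elim/big_ind: _ => // i _; elim/big_ind: _ => // s _.
have exs : peirce (e i) (e s) ((e i : R) * x * (e s : R)) by exists x.
have [eis|nis] := eqVneq i s; last first.
  exact/JQ/(peirce_off_diagonal_jacobson spR (pe i) (pe s) (basic_e nis)).
subst s; case: (pselect (H (e i))) => [Hi|nHi].
  exists 0; first exact: right_ideal0.
  by rewrite subr0 -[_ * x * _]mulr1; apply: LayerTraceIdem.
apply: JQ; apply: (peirce_layer_jacobson nHi) exs.
exact/right_idealMr/idealMl.
Qed.

(* As H^2 = H modulo I, H lies in J^k + layer_trace for all k, and J is
   nilpotent. *)
Lemma layer_generated x : H x -> layer_trace x.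
Proof.
have [HH _ _] := (heredity_quotientP IH).1 hered.
suff pw k y : H y -> exists2 z, set_pow J k z & layer_trace (y - z).
  have [[k Jk] _] := spR; move=> /(pw k)[z]; rewrite Jk => ->.
  by rewrite subr0.
elim: k y => [|k IHk] {}x {}Hx.
  by exists x => //; rewrite subrr; apply/LayerTraceI/right_ideal0.
have [y HHy Ixy] := HH x Hx.
suff [z Jz yz] : exists2 z, set_pow J k.+1 z & layer_trace (y - z).
  exists z => //; rewrite -(subrK y x) -addrA; apply: LayerTraceD => //.
  exact: LayerTraceI.
move: y HHy {Ixy}; apply: set_prod_elim => [|a b [j Jj aj] [z Jz bz]|a b Ha Hb].
- by exists 0; [apply: set_prod0|rewrite subrr; apply/LayerTraceI/right_ideal0].
- exists (j + z); first exact: set_prodD.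
  by rewrite opprD addrACA; apply: LayerTraceD.
have [j Jj aj] := layer_trace_mod_jacobson Ha; have [z Jz bz] := IHk b Hb.
exists (j * z); first exact: set_prod_mul.
(* [a * b - j * z = (a - j) * b + j * (b - z)]. *)
rewrite -[a * b](subrK (j * b)) -mulrBl -addrA -mulrBr.
apply: LayerTraceD; first by rewrite -[a - j]mul1r; apply: layer_trace_mul.
by rewrite -[j * _]mulr1; apply: layer_trace_mul.
Qed.

(** By [layer_generated], [y] may be taken as [a * e s * b] with [e s] in [H]. Then [s] differs from
    [i], so [e i * a * e s] is in [J] and the product is in [H J H]. *)
Lemma layer_middle i x y : ~ H (e i) -> H x -> H y -> I (x * (e i : R) * y).
Proof.
have [pe _ _] := comp_e; move=> nHi Hx /layer_generated.
elim=> {y} [s a b Hs|y Iy|a b _ Ia _ Ib].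
- have ias : peirce (e i) (e s) ((e i : R) * a * (e s : R)) by exists a.
  have nis : i != s by apply/eqP => eis; rewrite eis in nHi.
  have Jias := peirce_off_diagonal_jacobson spR (pe i) (pe s) (basic_e nis) ias.
  have := right_idealMr b (layer_jacobson Hx Jias Hs).
  by rewrite !mulrA -(mulrA _ (e s : R) (e s : R)) idempotentP.
- exact: idealMl.
- by rewrite mulrDr; apply: right_idealD.
Qed.

End HeredityLayer.

(** * The row ideals inside one layer *)

Section BlockLayer.
Context (R : pzRingType) (n : nat) (e : 'I_n -> idempotent_elt R).
Context (spR : semiprimary R) (comp_e : complete_primitive_orthogonal e).
Context (basic_e : basic_idempotents e) (l : 'I_n -> nat).

Local Notation B := (block_extension spR comp_e basic_e l).
Local Notation J := (jacobson R).
Local Notation index := 'I_(\sum_(i < n) l i).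
Local Notation idp := (@idem_at R n e l).
Implicit Types (p q r : index) (X Y Z : B) (x y : R).

Section BlockIdeal.
Context (K : ideal R).

Definition block_ideal_set : set B := [set X | forall p q, K (ent X p q)].

Fact block_ideal0 : block_ideal_set 0.
Proof. by move=> p q; rewrite ent0; apply: right_ideal0. Qed.

Fact block_idealB X Y :
  block_ideal_set X -> block_ideal_set Y -> block_ideal_set (X - Y).
Proof. by move=> KX KY p q; rewrite entB; apply: right_idealB. Qed.

Fact block_idealMr X Y : block_ideal_set X -> block_ideal_set (X * Y).
Proof.
by move=> KX p q; rewrite entM; apply: right_ideal_sum => r _; apply: right_idealMr.
Qed.

Fact block_idealMl Y X : block_ideal_set X -> block_ideal_set (Y * X).
Proof.
by move=> KX p q; rewrite entM; apply: right_ideal_sum => r _; apply: idealMl.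
Qed.

Definition block_ideal : ideal B :=
  @Ideal _ (RightIdeal block_ideal0 block_idealB block_idealMr) block_idealMl.

End BlockIdeal.

Context (I H : ideal R).
Hypothesis IH : I `<=` H.
Hypothesis hered : heredity_ideal (quotient_ideal I H).

Let HJH x y z : H x -> J y -> H z -> I (x * y * z).
Proof. exact: layer_jacobson. Qed.

Let Hrow p X Y q r : H (idp p) -> J (ent X p r) -> H (ent Y r q) ->
  I (ent X p r * ent Y r q).
Proof. by move=> Hp JX HY; rewrite -ent_idl; apply: HJH. Qed.

Section RowIdeal.
Context (k : nat).

Definition row_ideal_set : set B := [set X | (forall p q, H (ent X p q)) /\
  forall p q, H (idp p) -> (k <= pos p)%N -> I (ent X p q)].

Fact row_ideal0 : row_ideal_set 0.
Proof. by split=> [p q|p q _ _]; rewrite ent0; apply: right_ideal0. Qed.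

Fact row_idealB X Y : row_ideal_set X -> row_ideal_set Y -> row_ideal_set (X - Y).
Proof.
move=> [HX IX] [HY IY]; split=> [p q|p q Hp kp]; rewrite entB;
  apply: right_idealB => //.
  exact: IX.
exact: IY.
Qed.

Fact row_idealMr X Y : row_ideal_set X -> row_ideal_set (X * Y).
Proof.
move=> [HX IX]; split=> [p q|p q Hp kp]; rewrite entM;
  apply: right_ideal_sum => r _; apply: right_idealMr => //.
exact: IX.
Qed.

(** In a row [p] that must vanish modulo [I], a factor of [Y] not forced into [J] leads to the same
    or a later row of the block, where [X] vanishes modulo [I]; a factor in [J] gives a product in
    [H J H]. *)
Fact row_idealMl Y X : row_ideal_set X -> row_ideal_set (Y * X).
Proof.
move=> [HX IX]; split=> [p q|p q Hp kp]; rewrite entM;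
  apply: right_ideal_sum => r _; first exact: idealMl.
case: (boolP ((blk p == blk r) && (pos p <= pos r)%N)) => [/andP[/eqP pr c]|pr].
  apply/idealMl/IX; last exact: leq_trans c.
  by move: Hp; rewrite /idem_at pr.
by apply: Hrow => //; apply: entJ.
Qed.

Definition row_ideal : ideal B :=
  @Ideal _ (RightIdeal row_ideal0 row_idealB row_idealMr) row_idealMl.

Lemma block_ideal_row : block_ideal I `<=` row_ideal.
Proof. by move=> X IX; split=> [p q|p q _ _]; [apply/IH/IX|apply: IX]. Qed.

Lemma row_ideal_block : ((\sum_(i < n) l i).+1 <= k)%N -> row_ideal = block_ideal H.
Proof.
move=> lk; apply: ideal_ext; apply/seteqP; split=> X; first by case.
move=> HX; split=> // p q _ kp; have := leq_trans lk kp.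
by rewrite leqNgt pos_lt.
Qed.

End RowIdeal.

Lemma row_idealS k : row_ideal k `<=` row_ideal k.+1.
Proof. by move=> X [HX IX]; split=> // p q Hp kp; apply: IX => //; apply: ltnW. Qed.

Lemma ent_sum_diag_unit_mul (T : pred index) X p q :
  ent ((\sum_(r | T r) diag_unit spR comp_e basic_e r) * X) p q =
  if T p then ent X p q else 0.
Proof.
rewrite mulr_suml ent_sum; case: ifP => Tp.
  rewrite (bigD1 p) //= ent_diag_unit_mul eqxx [X in _ + X]big1 ?addr0 // =>
    r /andP[_ rp].
  by rewrite ent_diag_unit_mul eq_sym (negPf rp).
by rewrite big1 // => r Tr; rewrite ent_diag_unit_mul; case: eqP => // pr;
  rewrite pr Tr in Tp.
Qed.

(** The element [u] is in the larger ideal and is a left identity of it modulo the smaller one,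
    which gives idempotence and projectivity. The radical condition is checked on each product
    [ent X p s * ent Y s r * ent Z r q]. *)
Lemma row_step k : heredity_ideal (quotient_ideal (row_ideal k) (row_ideal k.+1)).
Proof.
pose T p := `[< H (idp p) >] && (pos p == k).
pose u : B := \sum_(p | T p) diag_unit spR comp_e basic_e p.
have uP X : row_ideal k.+1 X -> row_ideal k (X - u * X).
  move=> [HX IX]; split=> [p q|p q Hp kp]; rewrite entB ent_sum_diag_unit_mul.
    by case: ifP => _; rewrite ?subr0 // subrr; apply: right_ideal0.
  case: ifP => [_|/negP nTp]; first by rewrite subrr; apply: right_ideal0.
  rewrite subr0; apply: IX => //; rewrite ltn_neqAle kp andbT eq_sym.
  by apply/eqP => pk; apply: nTp; rewrite /T pk eqxx andbT; apply/asboolP.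
have Ku : row_ideal k.+1 u.
  have entu p q : ent u p q = if T p then ent (1 : B) p q else 0.
    by have := ent_sum_diag_unit_mul T 1 p q; rewrite mulr1.
  split=> [p q|p q Hp kp]; rewrite entu.
    case: ifP => [/andP[/asboolP Hp _]|_]; last exact: right_ideal0.
    by rewrite -ent_idl; apply: right_idealMr.
  by rewrite /T (gtn_eqF kp) andbF; apply: right_ideal0.
apply/(heredity_quotientP (@row_idealS k)); split.
- move=> X KX; exists (u * X); last exact: uP.
  exact: (set_prod_mul Ku KX).
- exact: (rel_projective_idempotent (@row_idealS k) Ku uP).
move=> X Y Z KX JY KZ; have [HX IX] := KX; have [HZ IZ] := KZ.
have [HXYZ _] : row_ideal k.+1 (X * Y * Z) by apply/right_idealMr/right_idealMr.
split=> // p q Hp; rewrite leq_eqVlt => /orP[/eqP kp|kp]; last first.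
  rewrite -mulrA entM; apply: right_ideal_sum => r _; apply/right_idealMr/IX => //.
rewrite entM; apply: right_ideal_sum => r _; rewrite entM mulr_suml.
apply: right_ideal_sum => s _.
(* When [idp r] is not in [H], it is the middle of a product from [H * idp r * H], which lies in
   [I]. *)
case: (pselect (H (idp r))) => [Hr|nHr]; last first.
  rewrite -[ent Z r q]ent_idl mulrA;
    apply: (layer_middle spR comp_e basic_e IH hered) => //.
  by apply: right_idealMr; apply: HX.
case: (boolP ((blk s == blk r) && (pos s <= pos r)%N)) =>
  [/andP[/eqP sr csr]|sr]; last first.
  by apply: HJH => //; apply: entJ.
have [kr|rk] := ltnP k (pos r); first by apply/idealMl/IZ.
case: (boolP ((blk p == blk s) && (pos p <= pos s)%N)) =>
  [/andP[/eqP ps cps]|ps]; last first.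
  by rewrite -mulrA -[ent X p s]ent_idl; apply: HJH => //; [apply: entJ|apply: idealMl].
(* Only forward moves from position [k] to a position at most [k] are left, so the middle factor is
   diagonal. *)
have rs : r = s.
  apply: blk_pos_inj => //; apply/eqP; rewrite eqn_leq csr andbT.
  by apply: leq_trans rk _; rewrite kp.
(* Either the diagonal unit vanishes in the quotient, and [idp r] is in [I], or the middle factor is
   in [J]. *)
subst s; case: (pselect (row_ideal k (diag_unit spR comp_e basic_e r))) =>
  [[_ /(_ r r)]|nK].
  rewrite ent_diag_unit eqxx => /(_ Hr) Ir; rewrite -[ent Y r r]ent_idl;
    rewrite -mulrA -mulrA.
  by apply/idealMl/right_idealMr/Ir; rewrite kp.
by apply: HJH => //; apply: quotient_jacobson_diag nK JY.
Qed.

End BlockLayer.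

(** * The last step of a layer, through the corner at the first positions *)

Section FirstStep.
Context (R : pzRingType) (n : nat) (e : 'I_n -> idempotent_elt R).
Context (spR : semiprimary R) (comp_e : complete_primitive_orthogonal e).
Context (basic_e : basic_idempotents e) (l : 'I_n -> nat).
Hypothesis l_gt0 : forall i, (0 < l i)%N.

Local Notation B := (block_extension spR comp_e basic_e l).
Local Notation J := (jacobson R).
Local Notation index := 'I_(\sum_(i < n) l i).
Local Notation idp := (@idem_at R n e l).
Local Notation diag_unit := (diag_unit spR comp_e basic_e).
Local Notation single := (single spR comp_e basic_e).
Local Notation block_of_fun := (block_of_fun spR comp_e basic_e).
Implicit Types (p q r : index) (X Y Z : B) (x y : R).

Definition first_of i : index := tagnat.Rank i (Ordinal (l_gt0 i)).

Lemma blk_first_of i : blk (first_of i) = i. Proof. exact: blk_Rank. Qed.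
Lemma pos_first_of i : pos (first_of i) = 0%N. Proof. exact: pos_Rank. Qed.

Lemma first_of_blk p : pos p = 0%N -> first_of (blk p) = p.
Proof. by move=> p0; apply: blk_pos_inj; rewrite ?blk_first_of ?pos_first_of. Qed.

Lemma idem_at_first_of i : idp (first_of i) = e i.
Proof. by rewrite /idem_at blk_first_of. Qed.

(** Each block has exactly one position 0, so these idempotents are the [e i], whose sum is 1. *)
Lemma sum_idem_at_first x y : \sum_(r | pos r == 0%N) x * idp r * y = x * y.
Proof.
have [_ _ e1] := comp_e.
rewrite (reindex_onto first_of (fun r => blk r)) => [|r /eqP]; last exact: first_of_blk.
rewrite -mulr_suml -mulr_sumr (eq_big predT (fun i => e i : R)) ?e1 ?mulr1 // => i.
  by rewrite pos_first_of blk_first_of !eqxx.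
by rewrite idem_at_first_of.
Qed.

(** Within its own block a first row carries no radical condition, as position 0 comes before all
    others. *)
Lemma shape_first_of i q x : entry_shape e (first_of i) q ((e i : R) * x * idp q).
Proof.
have [pe _ _] := comp_e.
have ex : peirce (e i) (e (blk q)) ((e i : R) * x * idp q) by exists x.
split; rewrite blk_first_of // pos_first_of leq0n andbT => iq.
exact: (peirce_off_diagonal_jacobson spR (pe i) (pe _) (basic_e iq)).
Qed.

(* The embedding of R onto the corner of B at the first positions of the blocks;
   it does not preserve the identity. *)
Definition corner_map y : B :=
  block_of_fun (fun p q =>
    if (pos p == 0%N) && (pos q == 0%N) then idp p * y * idp q else 0).

Lemma ent_corner_map y p q : ent (corner_map y) p q =
  if (pos p == 0%N) && (pos q == 0%N) then idp p * y * idp q else 0.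
Proof.
rewrite block_of_funE // => {}p {}q; case: ifP => [/andP[/eqP p0 _]|_];
  last exact: shape0.
by have := shape_first_of (blk p) q y; rewrite first_of_blk.
Qed.

Lemma corner_mapD : {morph corner_map : x y / x + y}.
Proof.
move=> x y; apply: ent_inj => p q; rewrite entD !ent_corner_map.
by case: ifP; rewrite ?addr0 // mulrDr mulrDl.
Qed.

Lemma corner_mapM : {morph corner_map : x y / x * y}.
Proof.
move=> x y; apply: ent_inj => p q; rewrite entM ent_corner_map.
rewrite (eq_bigr (fun r => if pos r == 0%N then
    (if (pos p == 0%N) && (pos q == 0%N) then idp p * x * idp r * (y * idp q) else 0)
    else 0)); last first.
  move=> r _; rewrite !ent_corner_map; case: (pos p == 0%N);
    rewrite /= ?mul0r ?if_same //.
  case: (pos r == 0%N); rewrite /= ?mul0r //.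
  by case: (pos q == 0%N);
    rewrite ?mulr0 // !mulrA -(mulrA _ (idp r) (idp r)) idem_at_idem.
rewrite -big_mkcond /=; case: ifP => _; last by rewrite big1.
by rewrite sum_idem_at_first !mulrA.
Qed.

(** Right multiplication by it moves the first column of the block of [q] to column [q]. *)
Definition from_first q : B := single (first_of (blk q)) q (idp q).

Lemma shape_from_first q : entry_shape e (first_of (blk q)) q (idp q).
Proof. by have := shape_first_of (blk q) q 1; rewrite mulr1 /idem_at idempotentP. Qed.

(** Turns right multiplication by an arbitrary [X] into the action of the corner, which is what
    linearity of the lift in [first_step_projective] requires. *)
Lemma from_first_mul q X :
  from_first q * X = \sum_r corner_map (ent X q r) * from_first r.
Proof.
apply: ent_inj => p s; rewrite ent_single_mul ?ent_idl; last exact: shape_from_first.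
rewrite ent_sum (bigD1 s) //= [X in _ + X]big1 ?addr0; last first.
  move=> r rs; rewrite ent_mul_single; last exact: shape_from_first.
  by rewrite eq_sym (negPf rs).
rewrite ent_mul_single ?eqxx; last exact: shape_from_first.
rewrite ent_corner_map pos_first_of eqxx andbT idem_at_first_of.
case: eqP => [->|pq].
  by rewrite pos_first_of eqxx idem_at_first_of -/(idp q) ent_idl !ent_idr.
case: ifP => [/eqP p0|_]; last by rewrite mul0r.
rewrite -[ent X q s]ent_idl !mulrA idem_at_orth ?mul0r //.
by apply/eqP => b; apply: pq; rewrite -b first_of_blk.
Qed.

Context (I H : ideal R).
Hypothesis IH : I `<=` H.
Hypothesis hered : heredity_ideal (quotient_ideal I H).
Local Notation BI := (block_ideal spR comp_e basic_e l I).
Local Notation K1 := (row_ideal spR comp_e basic_e l IH hered 1).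

Let HJH x y z : H x -> J y -> H z -> I (x * y * z).
Proof. exact: layer_jacobson. Qed.

Let BIK1 : BI `<=` K1.
Proof. exact: block_ideal_row. Qed.

(* The rows of K1 which vanish modulo I. *)
Definition excluded p := `[< H (idp p) >] && (0 < pos p)%N.

Lemma first_step_ent X p q : K1 X -> excluded p -> I (ent X p q).
Proof. by move=> [_ IX] /andP[/asboolP Hp p0]; apply: IX. Qed.

(** By [layer_generated] the entry is, modulo [I], a sum of terms [x * e i * y] with [e i] in [H];
    each is a product of two single entries meeting at the first position of block [i]. *)
Lemma first_step_prod X p q : ~~ excluded p -> K1 X ->
  exists2 Y, set_prod K1 K1 Y &
    forall p' q', I ((if (p' == p) && (q' == q) then ent X p q else 0) - ent Y p' q').
Proof.
move=> np [HX _].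
have -> : ent X p q = idp p * ent X p q * idp q by rewrite ent_idl ent_idr.
have := layer_generated spR comp_e basic_e IH hered (HX p q).
elim=> [i x y Hi|x Ix|x y _ [Y KY YE] _ [Z KZ ZE]].
(* If [p] is in block [i], then [idp p] is in [H], and [p] not being excluded forces [pos p = 0]. *)
- have sp : entry_shape e p (first_of i) (idp p * x * (e i : R)).
    have ex : peirce (e (blk p)) (e i) (idp p * x * (e i : R)) by exists x.
    split; rewrite blk_first_of // pos_first_of;
      have [pi|pi _] := eqVneq (blk p) i => /=.
      rewrite leqn0 => p0; case/negP: np; rewrite /excluded lt0n p0 andbT.
      by apply/asboolP; rewrite /idem_at pi.
    have [pe _ _] := comp_e.
    exact: (peirce_off_diagonal_jacobson spR (pe _) (pe _) (basic_e pi)).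
  have sq := shape_first_of i q y.
  exists (single p (first_of i) (idp p * x * (e i : R)) *
          single (first_of i) q ((e i : R) * y * idp q)).
    apply: set_prod_mul; split=> [p' q'|p' q' Hp' p'0].
    + rewrite ent_single //; case: ifP => _; [exact: idealMl|exact: right_ideal0].
    + rewrite ent_single //; case: eqP => [pp|_]; last exact: right_ideal0.
      by case/negP: np; rewrite /excluded -pp p'0 andbT; apply/asboolP.
    + rewrite ent_single //; case: ifP => _; last exact: right_ideal0.
      exact/right_idealMr/right_idealMr.
    + rewrite ent_single //; case: eqP => [pp|_]; last exact: right_ideal0.
      by rewrite pp pos_first_of in p'0.
  move=> p' q'; rewrite ent_mul_single // ent_single //.
  case: (p' == p); case: (q' == q); rewrite /= ?eqxx ?mul0r ?subr0 ?subrr;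
    try exact: right_ideal0.
  rewrite !mulrA -(mulrA _ (e i : R) (e i : R)) idempotentP subrr; exact: right_ideal0.
- exists 0; first exact: set_prod0.
  move=> p' q'; rewrite ent0 subr0; case: ifP => _; last exact: right_ideal0.
  exact/right_idealMr/idealMl.
exists (Y + Z); first exact: set_prodD.
move=> p' q'; have := right_idealD (YE p' q') (ZE p' q').
rewrite entD opprD addrACA; case: ifP => _; last by rewrite addr0.
by rewrite mulrDr mulrDl.
Qed.

Lemma first_step_idempotent X : K1 X -> exists2 Y, set_prod K1 K1 Y & BI (X - Y).
Proof.
move=> KX.
have QD Y Z : (exists2 U, set_prod K1 K1 U & BI (Y - U)) ->
    (exists2 U, set_prod K1 K1 U & BI (Z - U)) ->
    exists2 U, set_prod K1 K1 U & BI (Y + Z - U).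
  move=> [U KU YU] [V KV ZV]; exists (U + V); first exact: set_prodD.
  by rewrite opprD addrACA; apply: right_idealD.
have QI Y : BI Y -> exists2 U, set_prod K1 K1 U & BI (Y - U).
  by move=> IY; exists 0; [apply: set_prod0|rewrite subr0].
have Q0 := QI 0 (right_ideal0 BI).
rewrite (single_decomposition X).
elim/big_ind: _ => // p _; elim/big_ind: _ => // q _.
have [xp|np] := boolP (excluded p).
  apply: QI => p' q'; rewrite ent_single; last exact: entP.
  by case: ifP => _; [apply: first_step_ent|apply: right_ideal0].
have [Y KY YE] := first_step_prod q np KX; exists Y => // p' q'.
by rewrite entB ent_single //; apply: entP.
Qed.

(** The cases are those of [row_step], now for every row [p]: with [r] at a first position, [s]
    equals [r], and the middle factor is in [J] or [idp r] is in [I]. *)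
Lemma first_step_jacobson X Y Z :
  K1 X -> jacobson (quotient_ring BI) (to_quotient BI Y) ->
  K1 Z -> BI (X * Y * Z).
Proof.
move=> [HX IX] JY [HZ IZ] p q.
rewrite entM; apply: right_ideal_sum => r _; rewrite entM mulr_suml.
apply: right_ideal_sum => s _.
case: (pselect (H (idp r))) => [Hr|nHr]; last first.
  rewrite -[ent Z r q]ent_idl mulrA;
    apply: (layer_middle spR comp_e basic_e IH hered) => //.
  by apply: right_idealMr; apply: HX.
case: (boolP ((blk s == blk r) && (pos s <= pos r)%N)) =>
  [/andP[/eqP sr csr]|sr]; last first.
  by apply: HJH => //; apply: entJ.
have [r0|r0] := ltnP 0 (pos r); first by apply/idealMl/IZ.
have rs : r = s.
  by apply: blk_pos_inj => //; apply/eqP; rewrite eqn_leq csr (leq_trans r0).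
subst s; case: (pselect (BI (diag_unit r))) => [/(_ r r)|nK].
  rewrite ent_diag_unit eqxx => Ir; rewrite -[ent Y r r]ent_idl -mulrA -mulrA.
  exact/idealMl/right_idealMr.
by apply: HJH => //; apply: quotient_jacobson_diag nK JY.
Qed.

(* H -> K1, x |-> row p with entries in the first columns of the blocks; outside
   H this may be the junk value of block_of_fun. *)
Definition row_map p x : B :=
  block_of_fun (fun p' q =>
    if [&& p' == p, ~~ excluded p & pos q == 0%N] then idp p * x * idp q else 0).

(** If [p] is neither first nor excluded, then [idp p] is outside [H], so the entry of [H] placed in
    its own block is in [J], as the shape demands. *)
Lemma ent_row_map p x p' q : H x -> ent (row_map p x) p' q =
  if [&& p' == p, ~~ excluded p & pos q == 0%N] then idp p * x * idp q else 0.
Proof.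
move=> Hx; rewrite block_of_funE // => {}p' {}q;
  case: ifP => [/and3P[/eqP-> np /eqP q0]|_]; last exact: shape0.
have [pe _ _] := comp_e.
have ex : peirce (e (blk p)) (e (blk q)) (idp p * x * idp q) by exists x.
split=> //; have [pq|pq _] := eqVneq (blk p) (blk q) => /=.
  rewrite q0 leqn0 => p0.
  apply: (peirce_layer_jacobson spR comp_e (i := blk p) (H := H)).
  + move=> Hp; case/negP: np; rewrite /excluded lt0n p0 andbT; exact/asboolP.
  + exact/right_idealMr/idealMl.
  + by rewrite {2}pq.
exact: (peirce_off_diagonal_jacobson spR (pe _) (pe _) (basic_e pq)).
Qed.

Lemma row_map_row_ideal p x : H x -> K1 (row_map p x).
Proof.
move=> Hx; split=> [p' q|p' q Hp' p'0]; rewrite ent_row_map //; case: ifP => [c|_];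
  try exact: right_ideal0; first exact/right_idealMr/idealMl.
case/and3P: c => /eqP pp /negP[]; rewrite /excluded -pp p'0 andbT; exact/asboolP.
Qed.

Lemma row_map_block_ideal p x : I x -> BI (row_map p x).
Proof.
move=> Ix p' q; rewrite ent_row_map; last exact: IH.
case: ifP => _; [exact/right_idealMr/idealMl|exact: right_ideal0].
Qed.

Lemma row_mapD p x y : H x -> H y -> row_map p (x + y) = row_map p x + row_map p y.
Proof.
move=> Hx Hy; apply: ent_inj => p' q; rewrite entD !ent_row_map //;
  last exact: right_idealD.
by case: ifP => _; rewrite ?addr0 // mulrDr mulrDl.
Qed.

Lemma row_mapM p x y : H x -> row_map p (x * y) = row_map p x * corner_map y.
Proof.
move=> Hx; apply: ent_inj => p' q; rewrite entM ent_row_map; last exact: right_idealMr.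
rewrite (eq_bigr (fun r => if pos r == 0%N then
    (if [&& p' == p, ~~ excluded p & pos q == 0%N]
     then idp p * x * idp r * (y * idp q) else 0)
    else 0)); last first.
  move=> r _; rewrite ent_row_map // ent_corner_map; case: (p' == p);
    rewrite /= ?mul0r ?if_same //.
  case: (excluded p); rewrite /= ?mul0r ?if_same //.
  case: (pos r == 0%N); rewrite /= ?mul0r //.
  by case: (pos q == 0%N);
    rewrite ?mulr0 // !mulrA -(mulrA _ (idp r) (idp r)) idem_at_idem.
rewrite -big_mkcond /=; case: ifP => _; last by rewrite big1.
by rewrite sum_idem_at_first !mulrA.
Qed.

(** Each entry is placed by [row_map p] in the first column of its block and moved back by
    [from_first q]; only the excluded rows are lost, and they vanish modulo [I]. *)
Lemma row_map_decomposition X :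
  K1 X -> BI (X - \sum_p \sum_q row_map p (ent X p q) * from_first q).
Proof.
move=> KX p q; have [HX _] := KX; rewrite entB.
suff -> : ent (\sum_p \sum_q row_map p (ent X p q) * from_first q) p q =
    if excluded p then 0 else ent X p q.
  by case: ifP => xp; rewrite ?subr0 ?subrr;
    [apply: first_step_ent|apply: right_ideal0].
rewrite ent_sum (bigD1 p) //= [X in _ + X]big1 ?addr0; last first.
  move=> r rp; rewrite ent_sum big1 // => s _; rewrite ent_mul_single;
    last exact: shape_from_first.
  by rewrite ent_row_map // [p == r]eq_sym (negPf rp) mul0r if_same.
rewrite ent_sum (bigD1 q) //= [X in _ + X]big1 ?addr0; last first.
  move=> s sq; rewrite ent_mul_single; last exact: shape_from_first.
  by rewrite [q == s]eq_sym (negPf sq).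
rewrite ent_mul_single ?eqxx; last exact: shape_from_first.
rewrite ent_row_map // pos_first_of !eqxx andbT idem_at_first_of /=;
  case: (excluded p) => /=; first by rewrite mul0r.
by rewrite ent_idl -/(idp q) !ent_idr.
Qed.

(** Along [row_map p], [phi] becomes a map on [H] that is linear through [corner_map]; projectivity
    of [H/I] lifts it to [psi p]. The lifts are glued by applying [psi p] to the entries of row [p]
    and acting by [from_first q]. *)
Lemma first_step_projective : rel_projective BI K1.
Proof.
move=> X Y g gs phi phiL; have [phiD phiM phi0] := phiL.
pose pi := to_quotient BI.
have [_ proj _] := (heredity_quotientP IH).1 hered.
pose rhoq x := pi (corner_map x).
have rhoqD : {morph rhoq : x y / x + y}.
  by move=> x y; rewrite /rhoq corner_mapD /pi to_quotientD.
have rhoqM : {morph rhoq : x y / x * y}.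
  by move=> x y; rewrite /rhoq corner_mapM /pi to_quotientM.
have rhoq0 x : I x -> rhoq x = 0.
  move=> Ix; apply/to_quotient_eq0 => p q; rewrite ent_corner_map.
  by case: ifP => _; [apply/right_idealMr/idealMl|apply: right_ideal0].
have psi_ex p : exists f : R -> X,
    nonunital_linear I H rhoq f /\ forall x, H x -> g (f x) = phi (row_map p x).
  have [|f fL fE] := rel_projective_nonunital IH rhoqD rhoqM rhoq0 proj gs
    (phi := phi \o row_map p).
    split=> /= [x y Hx Hy|x y Hx|x Ix].
    - by rewrite row_mapD // phiD //; apply: row_map_row_ideal.
    - by rewrite row_mapM // phiM //; apply: row_map_row_ideal.
    - by apply: phi0; apply: row_map_block_ideal.
  by exists f.
have [psi psiP] := choice psi_ex.
exists (fun Z => \sum_p \sum_q (pi (from_first q) : (quotient_ring BI)^c) *: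
  psi p (ent Z p q)).
  split=> [Z W [HZ _] [HW _]|Z W [HZ _]|Z IZ].
  - rewrite -big_split; apply: eq_bigr => p _; rewrite -big_split;
    apply: eq_bigr => q _ /=.
    have [[psiD _ _] _] := psiP p; by rewrite entD psiD // scalerDr.
  - rewrite scaler_sumr; apply: eq_bigr => p _.
    have [[psiD psiM psi0] _] := psiP p.
    have psi_sum q : psi p (ent (Z * W) p q) =
        \sum_r (rhoq (ent W r q) : (quotient_ring BI)^c) *: psi p (ent Z p r).
      rewrite entM (nonunital_linear_sum _ (proj1 (psiP p))) => [|r _].
        by apply: eq_bigr => r _; rewrite psiM.
      exact: right_idealMr.
    (* Swap the sums over [q] and [r]; [from_first_mul] then identifies the coefficient of each
       [psi p (ent Z p r)]. *)
    rewrite (eq_bigr _ (fun q _ => congr1 _ (psi_sum q))).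
    rewrite (eq_bigr _ (fun q _ => scaler_sumr _ _ _ _)) exchange_big scaler_sumr /=.
    apply: eq_bigr => r _.
    rewrite (eq_bigr _ (fun q _ => scalerA _ _ _)) -scaler_suml scalerA; congr (_ *: _).
    rewrite -[RHS]/(pi (from_first r) * pi W) -to_quotientM from_first_mul.
    rewrite (raddf_sum (to_quotient BI)); apply: eq_bigr => q _.
    by rewrite -[LHS]/(pi (corner_map (ent W r q)) * pi (from_first q)) -to_quotientM.
  - rewrite big1 // => p _; rewrite big1 // => q _.
    by have [[_ _ psi0] _] := psiP p; rewrite psi0 ?scaler0 //; apply: IZ.
move=> Z KZ; have [HZ _] := KZ.
have rowK p q : K1 (row_map p (ent Z p q) * from_first q).
  exact/right_idealMr/row_map_row_ideal.
(* Modulo [BI], [Z] becomes a sum of moved rows, on which [phi] is the image of the lifts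
   [psi p]. *)
rewrite (rel_linear_eq BIK1 phiL _ (row_map_decomposition KZ)); last first.
  by apply: right_ideal_sum => p _; apply: right_ideal_sum => q _.
rewrite (rel_linear_sum _ phiL); last first.
  by move=> p _; apply: right_ideal_sum => q _.
rewrite linear_sum; apply: eq_bigr => p _; rewrite (rel_linear_sum _ phiL) //.
rewrite linear_sum; apply: eq_bigr => q _.
have [_ gpsi] := psiP p.
by rewrite linearZ /= gpsi // phiM //; apply: row_map_row_ideal.
Qed.

Lemma first_step : heredity_ideal (quotient_ideal BI K1).
Proof.
apply/(heredity_quotientP BIK1); split.
- exact: first_step_idempotent.
- exact: first_step_projective.
- exact: first_step_jacobson.
Qed.

End FirstStep.

(** * Gluing the layers into a heredity chain *)

(** The chain stops at [K] instead of 0, so that it can be continued downwards. *)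
Definition heredity_chain_to (S : pzRingType) (K : ideal S) : Prop :=
  exists (m : nat) (G : nat -> ideal S),
    [/\ (G 0%N : set S) = setT, G m = K &
      forall i, (i < m)%N ->
        G i.+1 `<=` G i /\ heredity_ideal (quotient_ideal (G i.+1) (G i))].

Lemma heredity_chain_rcons (S : pzRingType) (K K' : ideal S) : K' `<=` K ->
  heredity_ideal (quotient_ideal K' K) -> heredity_chain_to K -> heredity_chain_to K'.
Proof.
move=> K'K hK [m [G [G0 Gm GS]]].
exists m.+1, (fun i => if (i <= m)%N then G i else K'); split=> [||i].
- by rewrite leq0n.
- by rewrite ltnn.
rewrite ltnS => im; rewrite im; case: ltnP => [|mi]; first exact: GS.
by have -> : i = m by [apply/eqP; rewrite eqn_leq im]; rewrite Gm.
Qed.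

Section BlockChain.
Context (R : pzRingType) (n : nat) (e : 'I_n -> idempotent_elt R).
Context (spR : semiprimary R) (comp_e : complete_primitive_orthogonal e).
Context (basic_e : basic_idempotents e) (l : 'I_n -> nat).
Hypothesis l_gt0 : forall i, (0 < l i)%N.

Local Notation block_ideal := (block_ideal spR comp_e basic_e l).

(** [block_ideal H] is the row ideal of an index beyond all positions; [row_step] descends from it
    to index 1, and [first_step] from there to [block_ideal I]. Consecutive row ideals may
    coincide. *)
Lemma block_chain_step (I H : ideal R) : I `<=` H ->
  heredity_ideal (quotient_ideal I H) ->
  heredity_chain_to (block_ideal H) -> heredity_chain_to (block_ideal I).
Proof.
move=> IH hered; rewrite -(row_ideal_block spR comp_e basic_e IH hered (leqnn _)).
elim: (\sum_(i < n) l i)%N => [|k IHk] hk.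
  by apply: heredity_chain_rcons hk; [apply: block_ideal_row|apply: first_step].
by apply: IHk; apply: heredity_chain_rcons hk; [apply: row_idealS|apply: row_step].
Qed.

Lemma block_chain m (H : nat -> ideal R) : heredity_chain m H ->
  exists (m' : nat) (G : nat -> ideal (block_extension spR comp_e basic_e l)),
    heredity_chain m' G.
Proof.
move=> [H0 Hm HS].
have chain k : (k <= m)%N -> heredity_chain_to (block_ideal (H k)).
  elim: k => [_|k IHk km].
    exists 0%N, (fun=> block_ideal (H 0%N)); split=> //.
    by apply/seteqP; split=> // X _ p q; rewrite H0.
  have [IH hered] := HS k km.
  exact: block_chain_step IH hered (IHk (ltnW km)).
have [m' [G [G0 Gm GS]]] := chain m (leqnn m).
exists m', G; split=> //; rewrite Gm; apply/seteqP; split=> [X HX|_ ->];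
  last exact: right_ideal0.
by apply: ent_inj => p q; rewrite ent0; have := HX p q; rewrite Hm.
Qed.

End BlockChain.

Theorem theorem1p2 (R : pzRingType) (n : nat) (e : 'I_n -> idempotent_elt R)
    (spR : semiprimary R)
    (comp_e : complete_primitive_orthogonal e)
    (basic_e : basic_idempotents e)
    (l : 'I_n -> nat) (l_gt0 : forall i, (0 < l i)%N) :
  quasi_hereditary R ->
  quasi_hereditary (block_extension spR comp_e basic_e l).
Proof.
move=> [_ [m [H chain]]]; split; first exact: semiprimary_block.
exact: block_chain chain.
Qed.
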